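(* There exist positive constants $\alpha$, $\delta$ and $M$ such that for all $0<\lambda\le\delta$, taking $K=2\left\lceil\frac{\delta}{\sqrt{\lambda}}\right\rceil$, $V=\{-K,\dots,K\}$ and $U=\{-\frac K2,\dots,\frac K2\}$, $$\sup_{\xi\in\{0,1\}^U}\ \sup_{\ell\in\mathbb{N}}\ \sum_{m\ge 0}\mathbb{E}_V^{\xi^m}\big[e^{\alpha S(m)}\mathbf{1}_{L(m)=\ell}\big]\le M,$$ where $\xi^m=\xi+m\delta_{0}$ is the configuration obtained by adding $m$ active walks at site $0$ to $\xi$, and $L(m)$ and $S(m)$ are, respectively, the number of walks that exit $V$ from the left and the number of walks sleeping in $V$ after $\xi^m$ is stabilized in $V$ under the Activated Random Walk dynamics with sleep rate $\lambda$.
   Context: Finite-volume Activated Random Walk (ARW) dynamics with sleep rate $\lambda>0$ on a finite interval $V\subseteq\mathbb{Z}$. Let $\mathbb{N}=\{0,1,2,\dots\}$ and $\mathbb{N}_{\mathfrak{s}}=\mathbb{N}\cup\{\mathfrak{s}\}$, where $\mathfrak{s}$ represents a single sleeping walk and $n\in\mathbb{N}$ represents $n$ active walks. Conventions: $|\mathfrak{s}|=1$, $|n|=n$; $\mathfrak{s}+1=2$; $n\cdot\mathfrak{s}=n$ for $n\ge 2$ and $1\cdot\mathfrak{s}=\mathfrak{s}$. The state at time $t$ is $\eta_t\in(\mathbb{N}_{\mathfrak{s}})^{V}$. At each site $x\in V$ a clock rings at rate $(1+\lambda)\,|\eta_t(x)|\,\mathbf{1}_{\eta_t(x)\neq\mathfrak{s}}$.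 When it rings, with probability $\frac{\lambda}{1+\lambda}$ the value $\eta(x)$ is replaced by $\eta(x)\cdot\mathfrak{s}$ (a walk tries to fall asleep, succeeding only if it is alone at $x$), and otherwise, with probability $\frac12\cdot\frac1{1+\lambda}$ for each of $y=x\pm1$, one walk jumps from $x$ to $y$: $\eta(x)$ becomes $\eta(x)-1$ and, if $y\in V$, $\eta(y)$ becomes $\eta(y)+1$ (so a sleeping walk at $y$ is reactivated); if $y\notin V$ the walk is lost forever (it exits from the left if $y$ is to the left of $V$, i.e. $y=-K-1$ when $V=\{-K,\dots,K\}$). Almost surely this process eventually stabilizes, i.e. all walks left in $V$ are sleeping. $\mathbb{E}^{\eta_0}_V$ denotes expectation when the initial configuration is $\eta_0$. A configuration $\xi\in\{0,1\}^U$ with $U\subseteq V$ is viewed as a configuration of active walks on $V$ equal to $0$ outside $U$ (value $1$ means one active walk). In $\xi+m\delta_0$, $\delta_0$ denotes the configuration with one active walk at site $0$; it is unrelated to the constant $\delta$. *)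

(* Defs.v *)
From HB Require Import structures.
From mathcomp Require Import all_boot all_order all_algebra.
From mathcomp Require Import all_classical all_reals all_analysis.
From mathcomp Require Import measurable_realfun.

Set Implicit Arguments.
Unset Strict Implicit.
Unset Printing Implicit Defensive.
Import Order.TTheory GRing.Theory Num.Theory numFieldNormedType.Exports.
Local Open Scope classical_set_scope.
Local Open Scope ring_scope.

(* Activated Random Walk on V = {-K, ..., K}.                                 *)

(* [Some n] stands for n active walks, [None] for one sleeping walk.          *)
Notation occupation := (option nat).

Definition active (n : nat) : occupation := Some n.
Definition asleep : occupation := None.

Definition nwalks (a : occupation) : nat := if a is Some n then n else 1.

Definition add1 (a : occupation) : occupation :=
  if a is Some n then active n.+1 else active 2.

(* [sub1 asleep], [fall_asleep (active 0)] and [fall_asleep asleep] are       *)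
(* irrelevant: clocks do not ring at empty sites or on sleeping walks.        *)
Definition sub1 (a : occupation) : occupation :=
  if a is Some n then active n.-1 else asleep.

Definition fall_asleep (a : occupation) : occupation :=
  if a is Some 1 then asleep else a.

(* The index i encodes the integer i - K.                                     *)
Definition site (K : nat) : finType := 'I_(K.*2.+1).
Definition pos (K : nat) (x : site K) : int := (nat_of_ord x)%:Z - K%:Z.

Definition config (K : nat) : countType := {ffun site K -> occupation}.

(* Configuration, and number of walks that have exited from the left so far.  *)
Definition state (K : nat) : countType := (config K * nat)%type.

Definition sleep_at (K : nat) (s : state K) (x : site K) : state K :=
  ([ffun z => if z == x then fall_asleep (s.1 z) else s.1 z], s.2).

(* A walk jumps from x to the integer y; when y is outside of V no site       *)
(* receives it.                                                               *)
Definition jump (K : nat) (s : state K) (x : site K) (y : int) : state K :=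
  ([ffun z => if z == x then sub1 (s.1 z)
              else if pos z == y then add1 (s.1 z) else s.1 z],
   (s.2 + (y < - K%:Z)%R)%N).

Definition stable (K : nat) (eta : config K) : Prop :=
  forall x, eta x = active 0 \/ eta x = asleep.

Section Dynamics.
Variables (R : realType) (K : nat) (lambda : R).

Definition rate (eta : config K) (x : site K) : R :=
  (1 + lambda) * (nwalks (eta x))%:R * (eta x != asleep)%:R.

Definition total_rate (eta : config K) : R := \sum_(x : site K) rate eta x.

(* Probability that a clock ring at x turns s into s'.                        *)
Definition ring_prob (s : state K) (x : site K) (s' : state K) : R :=
  lambda / (1 + lambda) * (s' == sleep_at s x)%:R
  + 2^-1 * (1 + lambda)^-1 * (s' == jump s x (pos x - 1))%:R
  + 2^-1 * (1 + lambda)^-1 * (s' == jump s x (pos x + 1))%:R.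

(* Transition probability of the state at the first clock ring; s is          *)
(* absorbing when no clock can ring.                                          *)
Definition step_prob (s s' : state K) : R :=
  if total_rate s.1 == 0 then (s' == s)%:R
  else \sum_(x : site K) rate s.1 x / total_rate s.1 * ring_prob s x s'.

(* Continuous-time Markov chain given by [Y n], the state after n clock       *)
(* rings, and [W n], the time elapsed between the n-th and (n+1)-st rings,    *)
(* under laws [P eta0] indexed by the initial configuration. Conditionally on *)
(* Y, the W n are independent exponential variables of parameter              *)
(* total_rate (Y n); parameter 0 means W n = +oo almost surely.               *)
Record ARW (d : measure_display) (T : measurableType d)
    (Y : nat -> T -> state K) (W : nat -> T -> \bar R)
    (P : config K -> probability T R) : Prop := {
  ARW_measurable_state : forall n s, measurable [set w | Y n w = s] ;
  ARW_measurable_time : forall n, measurable_fun [set: T] (W n) ;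
  ARW_time_ge0 : forall n w, (0 <= W n w)%E ;
  ARW_law : forall (eta0 : config K) (n : nat)
      (s : nat -> state K) (t : nat -> R),
    (forall i, 0 <= t i) ->
    P eta0 [set w | (forall i, (i <= n)%N -> Y i w = s i) /\
                    (forall i, (i < n)%N -> ((t i)%:E < W i w)%E)]
    = ((s 0%N == (eta0, 0%N))%:R *
       \prod_(i < n) (expR (- (total_rate (s i).1 * t i)) *
                      step_prob (s i) (s i.+1)))%:E }.

Section Trajectory.
Variables (d : measure_display) (T : measurableType d).
Variables (Y : nat -> T -> state K) (W : nat -> T -> \bar R).

Definition ring_time (n : nat) (w : T) : \bar R := (\sum_(i < n) W i w)%E.

(* State at time t; the default value only matters after an explosion.        *)
Definition state_at (t : R) (w : T) : state K :=
  Y (xget 0%N [set n | (ring_time n w <= t%:E < ring_time n.+1 w)%E]) w.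

(* The default value only matters on the null event of no stabilization.      *)
Definition final_state (w : T) : state K :=
  xget (Y 0 w) [set s | stable s.1 /\ \forall t \near +oo, state_at t w = s].

Definition left_exits (w : T) : nat := (final_state w).2.

Definition sleepers (w : T) : nat :=
  #|[set x | (final_state w).1 x == asleep]%SET|.

End Trajectory.
End Dynamics.

Definition centered (K k : nat) : {set site K} :=
  [set x | `|pos x| <= k%:Z]%SET.

(* {0,1}^U, extended by 0 outside of U.                                       *)
Definition zero_one (K : nat) (U : {set site K}) : set (config K) :=
  [set xi | (forall x, x \in U -> xi x = active 0 \/ xi x = active 1) /\
            (forall x, x \notin U -> xi x = active 0)].

Definition add_at0 (K m : nat) (xi : config K) : config K :=
  [ffun z => if pos z == 0 then iter m add1 (xi z) else xi z].

(* Main.v *)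
Require Import Defs.
From mathcomp Require Import all_boot all_order all_algebra.
From mathcomp Require Import all_classical all_reals all_analysis.
From mathcomp Require Import measurable_realfun.
From mathcomp Require Import ring lra zify.
Set Implicit Arguments.
Unset Strict Implicit.
Unset Printing Implicit Defensive.
Import Order.TTheory GRing.Theory Num.Theory numFieldNormedType.Exports.
Local Open Scope classical_set_scope.
Local Open Scope ring_scope.

(* By the abelian property the walks may be launched one at a time, each one   *)
(* being toppled until it sleeps or leaves V; one of the m added walks is      *)
(* launched whenever the configuration is stable. A sleeping walk has weight   *)
(* 8, an awakened one has weight 4, a walk of U that was not launched yet has  *)
(* weight 1. If L walks have exited from the left and the product of the       *)
(* weights is psi, the remaining terms of the series sum up to at most         *)
(*   16 + (15/16)^(l - L) (8 psi - 16)   if L <= l,   and 0 otherwise:         *)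
(* a walk launched from U exits from either side with probability at least     *)
(* 1/4; if it exits from the left then L increases; if it meets a sleeping     *)
(* walk on its way then psi is halved; and as lambda (K + 1)^2 <= 1/500 the    *)
(* walk seldom falls asleep before. That no mass escapes to infinity follows   *)
(* from the potential sum_x |eta(x)| (x + K + 1) (K + 1 - x), which decreases  *)
(* by 1 / (1 + lambda) in the mean at each clock ring.                         *)

(** For fixed l, the terms of the series are coupled: the added walks are kept in reserve, and one
    is released at 0 whenever the configuration is stable. The series becomes the mean of the sum of
    8^(number of sleepers) over the stable configurations met while exactly l walks have left V from
    the left. A walk launched from U leaves on each side with probability at least 1/4, up to
    attempts to sleep, whose mean cost is of order lambda (K + 1)^2. Hence the left count does not
    stay long at l. Moreover, once some walk sleeps, a walk launched elsewhere must wake it to leave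
    on its side, and this pulls the exponential weight down.

    The coupling rests on [step_mean_abelian] and [launch_sum_stable]. The functions [bnd] and
    [walk_bnd] are supersolutions, for whole configurations and for one walk in motion;
    [walk_bounded_step] and [config_bounded_walk] check this, [walk_config_bounded] joins them by
    induction, and [launch_sum_le] bounds every truncation by 16.

    Stopping after n rings neglects unstable states only, and their probability is O(1/n) by
    [unstable_ind_le]. Bounds on the jump chain pass to the given laws by [integral_le_iter], and
    [final_state_regular] identifies the continuous-time limit with a stable state of the jump
    chain. All this is assembled in [sum_expectation_le]. *)

Section Topplings.
Variable K : nat.
Implicit Types (eta : config K) (s : state K) (x y z w : site K).

Definition is_active (a : occupation) : bool := if a is Some n.+1 then true else false.

(* The three outcomes of a clock ring at x: [None] is an attempt to sleep,     *)
(* [Some false] a jump to the left, [Some true] a jump to the right.           *)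
Definition target (o : option bool) x z : bool :=
  if o is Some b then pos z == (if b then pos x + 1 else pos x - 1) else false.

(** One formula for [sleep_at] and both jumps, so that commutation is proved once. *)
Definition topple (o : option bool) x s : state K :=
  ([ffun z => if z == x then (if o is Some _ then sub1 else fall_asleep) (s.1 z)
              else if target o x z then add1 (s.1 z) else s.1 z],
   (s.2 + (o == Some false) && (nat_of_ord x == 0))%N).

(** Separates the walk being moved from the configuration it moves over. *)
Definition addw eta x : config K :=
  [ffun z => if z == x then add1 (eta z) else eta z].

Definition upd eta x a : config K := [ffun z => if z == x then a else eta z].

Lemma sleep_atE s x : sleep_at s x = topple None x s.
Proof. by congr (_, _); rewrite addn0. Qed.

Lemma jump_leftE s x : jump s x (pos x - 1) = topple (Some false) x s.
Proof.
congr (_, _); congr (_ + nat_of_bool _)%N; rewrite eqxx /=.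
by rewrite /pos; lia.
Qed.

Lemma jump_rightE s x : jump s x (pos x + 1) = topple (Some true) x s.
Proof.
congr (_, _); congr (_ + nat_of_bool _)%N.
by rewrite /pos /=; lia.
Qed.

Lemma is_active_add1 a : is_active (add1 a).
Proof. by case: a. Qed.

Lemma active_topple_other o x y s :
  x != y -> is_active (s.1 x) -> is_active ((topple o y s).1 x).
Proof.
move=> xy ax; rewrite ffunE (negbTE xy).
by case: ifP => // _; exact: is_active_add1.
Qed.

(** The delicate case is a lone walk trying to sleep: an arrival before the attempt prevents the
    sleep, an arrival after it undoes the sleep, and the site holds 2 active walks either way. *)
Lemma topple_out_add1 (o : option bool) a : is_active a ->
  (if o is Some _ then sub1 else fall_asleep) (add1 a)
  = add1 ((if o is Some _ then sub1 else fall_asleep) a).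
Proof. by case: o => [?|]; case: a => [[|[|n]]|]. Qed.

Lemma topple_comm o o' x y s : x != y -> is_active (s.1 x) -> is_active (s.1 y) ->
  topple o x (topple o' y s) = topple o' y (topple o x s).
Proof.
move=> xy ax ay; congr (_, _); last by rewrite /= addnAC.
apply/ffunP => z; rewrite /= !ffunE.
have [->|zx] := eqVneq z x.
  rewrite (negbTE xy); case: ifP => // _; exact: topple_out_add1.
have [->|zy] := eqVneq z y; last by case: ifP => _; case: ifP.
by case: ifP => // _; rewrite topple_out_add1.
Qed.

Lemma topple_iter_add1 o x m v s : is_active (s.1 x) ->
  topple o x ([ffun z => if v z then iter m add1 (s.1 z) else s.1 z], s.2)
  = ([ffun z => if v z then iter m add1 ((topple o x s).1 z) else (topple o x s).1 z],
     (topple o x s).2).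
Proof.
move=> ax; congr (_, _); apply/ffunP => z; rewrite /= !ffunE.
have [->|zx] := eqVneq z x; case: (v _) => //; last first.
  by case: ifP => // _; rewrite -iterSr.
elim: m => //= m <-; rewrite topple_out_add1 //.
by elim: m => //= m _; exact: is_active_add1.
Qed.

Lemma addwE eta x y : x != y -> addw eta x y = eta y.
Proof. by move=> xy; rewrite ffunE eq_sym (negbTE xy). Qed.

Lemma addw_same eta x : addw eta x x = add1 (eta x).
Proof. by rewrite ffunE eqxx. Qed.

Lemma active_addw eta x : is_active (addw eta x x).
Proof. by rewrite addw_same is_active_add1. Qed.

Lemma addw_asleep eta x : eta x = None -> addw eta x = addw (upd eta x (Some 1)) x.
Proof.
move=> ex; apply/ffunP => z; rewrite !ffunE; case: eqP => // ->.
by rewrite ex.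
Qed.

Lemma active_addwP eta x : is_active (eta x) ->
  exists2 n, eta x = Some n.+1 & eta = addw (upd eta x (Some n)) x.
Proof.
case e : (eta x) => [[|n]|] // _; exists n => //.
by apply/ffunP => z; rewrite !ffunE; case: eqP => // ->; rewrite e.
Qed.

Lemma topple_sleep_alone eta x L : eta x = Some 0 ->
  topple None x (addw eta x, L) = (upd eta x None, L).
Proof.
move=> ex; congr (_, _); last by rewrite /= addn0.
by apply/ffunP => z; rewrite /= !ffunE; case: eqP => // ->; rewrite ex.
Qed.

Lemma topple_sleep_accompanied eta x L n : eta x = Some n.+1 ->
  topple None x (addw eta x, L) = (addw eta x, L).
Proof.
move=> ex; congr (_, _); last by rewrite /= addn0.
by apply/ffunP => z; rewrite /= !ffunE; case: eqP => // ->; rewrite ex.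
Qed.

Lemma topple_jump eta x y b L : eta x <> None ->
  nat_of_ord y = (if b then x.+1 else x.-1) -> y != x ->
  topple (Some b) x (addw eta x, L) = (addw eta y, L).
Proof.
move=> ex yE yx; congr (_, _); last first.
  move: yx; rewrite -(inj_eq val_inj) /=.
  by case: b yE => /= -> // xx; rewrite -[X in _ = X]addn0; congr addn; lia.
apply/ffunP => z; rewrite /= !ffunE.
have [->|zx] := eqVneq z x.
  by rewrite eq_sym (negbTE yx); case: (eta x) ex.
congr (if _ then _ else _); rewrite /pos -(inj_eq val_inj) /=.
by move: yx; rewrite -(inj_eq val_inj) /=; case: b yE => /= -> ?; lia.
Qed.

Lemma topple_exit eta x b L : eta x <> None ->
  nat_of_ord x = (if b then K.*2 else 0%N) ->
  topple (Some b) x (addw eta x, L) = (eta, (L + ~~ b)%N).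
Proof.
move=> ex xE; congr (_, _); last by case: b xE => //= ->.
apply/ffunP => z; rewrite /= !ffunE.
have [->|zx] := eqVneq z x; first by case: (eta x) ex.
case: ifP => //; rewrite /pos => /eqP.
by case: b xE => /= xE; have := ltn_ord z; lia.
Qed.

End Topplings.

(** * Mean jump chain and abelian property *)

Section ExitTime.
Variables (R : realType) (K : nat).

(* In the coordinate c = i + 1 the walk exits V at c = 0 and c = exit_point, *)
(* and c (exit_point - c) is the mean number of jumps that this takes.       *)
Definition exit_point : nat := K.*2.+2.

Definition exit_time (c : nat) : R := c%:R * (exit_point%:R - c%:R).

Lemma exit_time_ge0 (x : site K) : 0 <= exit_time x.+1.
Proof.
by rewrite /exit_time mulr_ge0 // subr_ge0 ler_nat /exit_point; have := ltn_ord x; lia.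
Qed.

Lemma exit_time_mean c :
  2^-1 * exit_time c + 2^-1 * exit_time c.+2 = exit_time c.+1 - 1.
Proof. by rewrite /exit_time -!natr1; field. Qed.

End ExitTime.
Section JumpChain.
Variables (R : realType) (K : nat) (lambda : R).
Hypothesis lambda_gt0 : 0 < lambda.
Implicit Types (eta : config K) (s : state K) (x y : site K) (g : state K -> R).

Definition outcome_prob (o : option bool) : R :=
  if o is Some _ then 2^-1 * (1 + lambda)^-1 else lambda / (1 + lambda).

Definition toppling_mean x g s : R :=
  \sum_(o : option bool) outcome_prob o * g (topple o x s).

(** The averaging operator of the jump chain: its n-th iterate gives the mean of g after n rings. *)
Definition step_mean g s : R :=
  if total_rate lambda s.1 == 0 then g s
  else \sum_x rate lambda s.1 x / total_rate lambda s.1 * toppling_mean x g s.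

Lemma sum_option_bool (F : option bool -> R) :
  \sum_o F o = F None + F (Some false) + F (Some true).
Proof.
rewrite (bigD1 None) // (bigD1 (Some false)) // (bigD1 (Some true)) //=.
by rewrite big1 ?addr0 ?addrA // => -[[]|].
Qed.

Let lambda1_gt0 : 0 < 1 + lambda.
Proof. by rewrite addr_gt0. Qed.

Let lambda1_neq0 : 1 + lambda != 0.
Proof. exact: lt0r_neq0. Qed.

Lemma outcome_prob_ge0 o : 0 <= outcome_prob o.
Proof.
have l0 : 0 <= lambda by exact: ltW.
by case: o => [b|] /=; rewrite ?mulr_ge0 ?divr_ge0 ?invr_ge0 ?addr_ge0.
Qed.

Lemma outcome_prob_sum : \sum_o outcome_prob o = 1.
Proof. by rewrite sum_option_bool /=; field. Qed.

Lemma rate_ge0 eta x : 0 <= rate lambda eta x.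
Proof. by rewrite /rate !mulr_ge0 // ltW. Qed.

Lemma rate_eq0 eta x : (rate lambda eta x == 0) = ~~ is_active (eta x).
Proof.
rewrite /rate !mulf_eq0 (negbTE lambda1_neq0) /=.
by case: (eta x) => [[|n]|] //=; rewrite ?eqxx ?oner_eq0 ?pnatr_eq0 ?orbT.
Qed.

Lemma total_rate_eq0 eta :
  (total_rate lambda eta == 0) = [forall x, ~~ is_active (eta x)].
Proof.
rewrite /total_rate psumr_eq0 => [|x _]; last exact: rate_ge0.
apply/allP/forallP => [h x|h x _] /=.
  by have := h x (mem_index_enum x); rewrite /= rate_eq0.
by rewrite rate_eq0.
Qed.

Lemma total_rate_ge0 eta : 0 <= total_rate lambda eta.
Proof. by apply: sumr_ge0 => x _; exact: rate_ge0. Qed.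

Lemma stableP eta : reflect (stable eta) (total_rate lambda eta == 0).
Proof.
rewrite total_rate_eq0; apply: (iffP forallP) => h x; have := h x.
  by case: (eta x) => [[|n]|] //; [left|right].
by case=> ->.
Qed.

Lemma active_unstable eta x :
  is_active (eta x) -> (total_rate lambda eta == 0) = false.
Proof.
by move=> ax; rewrite total_rate_eq0; apply/negbTE/forallPn; exists x; rewrite ax.
Qed.

Lemma step_mean_stable g s : total_rate lambda s.1 == 0 -> step_mean g s = g s.
Proof. by rewrite /step_mean => ->. Qed.

Lemma iter_step_mean_stable g n s :
  total_rate lambda s.1 == 0 -> iter n step_mean g s = g s.
Proof. by move=> h; elim: n => //= n; rewrite step_mean_stable. Qed.

Lemma step_mean_const g s x c : is_active (s.1 x) ->
  (forall y, is_active (s.1 y) -> toppling_mean y g s = c) -> step_mean g s = c.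
Proof.
move=> ax h; have tot := active_unstable ax; rewrite /step_mean tot.
rewrite (eq_bigr (fun y => rate lambda s.1 y / total_rate lambda s.1 * c)).
  rewrite -mulr_suml -mulr_suml -/(total_rate lambda s.1) divff ?mul1r //.
  by rewrite tot.
move=> y _; case ay : (is_active (s.1 y)); first by rewrite h.
by have := rate_eq0 s.1 y; rewrite ay /= => /eqP ->; rewrite !mul0r.
Qed.

Lemma toppling_mean_comm x y g s : x != y -> is_active (s.1 x) ->
  is_active (s.1 y) ->
  toppling_mean x (toppling_mean y g) s = toppling_mean y (toppling_mean x g) s.
Proof.
move=> xy ax ay; rewrite /toppling_mean.
under eq_bigr do rewrite mulr_sumr.
rewrite exchange_big; apply: eq_bigr => o _; rewrite mulr_sumr.
by apply: eq_bigr => o' _; rewrite -(topple_comm o' o xy) // mulrCA.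
Qed.

Lemma eq_toppling_mean x g g' s :
  (forall o, g (topple o x s) = g' (topple o x s)) ->
  toppling_mean x g s = toppling_mean x g' s.
Proof. by move=> h; apply: eq_bigr => o _; rewrite h. Qed.

Lemma toppling_mean0 x y g s :
  (forall s', total_rate lambda s'.1 != 0 -> g s' = 0) ->
  is_active (s.1 x) -> x != y -> toppling_mean y g s = 0.
Proof.
move=> g0 ax xy; rewrite /toppling_mean big1 // => o _; rewrite g0 ?mulr0 //.
by rewrite (@active_unstable _ x) // active_topple_other.
Qed.

(* Abelian property: the chain may begin with a toppling at any active site.   *)
Lemma step_mean_abelian g n s x :
  (forall s', total_rate lambda s'.1 != 0 -> g s' = 0) ->
  is_active (s.1 x) ->
  iter n.+1 step_mean g s = toppling_mean x (iter n step_mean g) s.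
Proof.
move=> g0; elim: n s x => [|n IH] s x ax; rewrite iterS;
  apply: (@step_mean_const _ _ x) => // y ay.
- have [->//|yx] := eqVneq y x.
  (* With two active sites one toppling cannot stabilize, so both means vanish. *)
  by rewrite (toppling_mean0 g0 ax) 1?eq_sym // (toppling_mean0 g0 ay).
- have [->//|yx] := eqVneq y x.
  (* After the toppling at y, x is still active: the induction hypothesis makes x the next site, the
     two topplings are exchanged, and the hypothesis at y is used backwards. *)
  rewrite (@eq_toppling_mean _ _ (toppling_mean x (iter n step_mean g))); last first.
    by move=> o; rewrite (IH _ x) // active_topple_other // eq_sym.
  rewrite toppling_mean_comm //; apply: eq_toppling_mean => o.
  by rewrite (IH _ y) // active_topple_other.
Qed.

Definition add0 m s : state K := (add_at0 m s.1, s.2).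

Lemma topple_add0 o x m s : is_active (s.1 x) ->
  topple o x (add0 m s) = add0 m (topple o x s).
Proof. by move=> ax; exact: topple_iter_add1. Qed.

Lemma active_iter_add1 m a : is_active a -> is_active (iter m add1 a).
Proof. by move=> aa; elim: m => //= m _; exact: is_active_add1. Qed.

Lemma active_add0 m x s : is_active (s.1 x) -> is_active ((add0 m s).1 x).
Proof. by move=> ax; rewrite ffunE; case: ifP => // _; exact: active_iter_add1. Qed.

(** The series truncated to k terms and n rings. All its terms share the walks of [s], so one
    toppling there acts on all of them. *)
Definition launch_sum g k n s : R := \sum_(m < k) iter n step_mean g (add0 m s).

Lemma launch_sum_topple g k n s x :
  (forall s', total_rate lambda s'.1 != 0 -> g s' = 0) ->
  is_active (s.1 x) ->
  launch_sum g k n.+1 s = toppling_mean x (launch_sum g k n) s.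
Proof.
move=> g0 ax; rewrite /launch_sum /toppling_mean.
under [RHS]eq_bigr do rewrite mulr_sumr.
rewrite exchange_big; apply: eq_bigr => m _.
rewrite (step_mean_abelian _ g0 (active_add0 m ax)).
by apply: eq_bigr => o _; rewrite topple_add0.
Qed.

Lemma launch_sum0 g k s x :
  (forall s', total_rate lambda s'.1 != 0 -> g s' = 0) ->
  is_active (s.1 x) -> launch_sum g k 0 s = 0.
Proof.
move=> g0 ax; rewrite /launch_sum big1 // => m _ /=.
by apply: g0; rewrite (active_unstable (active_add0 m ax)).
Qed.

Lemma add0_0 s : add0 0 s = s.
Proof. by case: s => eta L; congr (_, _); apply/ffunP => z; rewrite ffunE; case: ifP. Qed.

Lemma add0S m s : add0 m (add0 1 s) = add0 m.+1 s.
Proof.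
congr (_, _); apply/ffunP => z; rewrite /= !ffunE.
by case: (pos z == 0) => //; exact: (esym (iterSr _ _ _)).
Qed.

(** The term m = 0 is settled; every other term still has a walk in reserve, and they all release
    one together. *)
Lemma launch_sum_stable g k n s : total_rate lambda s.1 == 0 ->
  launch_sum g k.+1 n s = g s + launch_sum g k n (add0 1 s).
Proof.
move=> st; rewrite /launch_sum big_ord_recl add0_0 iter_step_mean_stable //.
by congr (_ + _); apply: eq_bigr => m _; rewrite add0S.
Qed.

Lemma step_mean_ge0 g : (forall s, 0 <= g s) -> forall s, 0 <= step_mean g s.
Proof.
move=> g0 s; rewrite /step_mean; case: ifP => // _; apply: sumr_ge0 => x _.
rewrite mulr_ge0 ?divr_ge0 ?rate_ge0 ?total_rate_ge0 //.
by apply: sumr_ge0 => o _; rewrite mulr_ge0 // outcome_prob_ge0.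
Qed.

Lemma iter_step_mean_ge0 g n : (forall s, 0 <= g s) ->
  forall s, 0 <= iter n step_mean g s.
Proof. by move=> g0; elim: n => //= n IH; exact: step_mean_ge0. Qed.

Lemma toppling_meanD x g g' s : toppling_mean x (fun s => g s + g' s) s
  = toppling_mean x g s + toppling_mean x g' s.
Proof. by rewrite -big_split; apply: eq_bigr => o _; exact: mulrDr. Qed.

Lemma toppling_meanZ x c g s :
  toppling_mean x (fun s => c * g s) s = c * toppling_mean x g s.
Proof. by rewrite /toppling_mean mulr_sumr; apply: eq_bigr => o _; exact: mulrCA. Qed.

Lemma step_meanD g g' s :
  step_mean (fun s => g s + g' s) s = step_mean g s + step_mean g' s.
Proof.
rewrite /step_mean; case: ifP => // _; rewrite -big_split; apply: eq_bigr => x _.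
by rewrite toppling_meanD mulrDr.
Qed.

Lemma step_meanZ c g s : step_mean (fun s => c * g s) s = c * step_mean g s.
Proof.
rewrite /step_mean; case: ifP => // _; rewrite mulr_sumr; apply: eq_bigr => x _.
by rewrite toppling_meanZ mulrCA.
Qed.

Lemma iter_step_mean_lin c g g' n s :
  iter n step_mean (fun s => g s + c * g' s) s
  = iter n step_mean g s + c * iter n step_mean g' s.
Proof.
elim: n s => //= n IH s; rewrite -step_meanZ -step_meanD.
by congr step_mean; apply/funext => s'; rewrite IH.
Qed.

Lemma le_step_mean g g' : (forall s, g s <= g' s) ->
  forall s, step_mean g s <= step_mean g' s.
Proof.
move=> gg' s; have /step_mean_ge0/(_ s) : forall s, 0 <= g' s + (-1) * g s.
  by move=> s'; have := gg' s'; lra.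
by rewrite step_meanD step_meanZ; lra.
Qed.

(** * The decreasing potential and the speed of stabilization *)

Definition potential s : R := \sum_x (nwalks (s.1 x))%:R * exit_time R K x.+1.

Lemma potential_ge0 s : 0 <= potential s.
Proof. by apply: sumr_ge0 => x _; rewrite mulr_ge0 // exit_time_ge0. Qed.

Lemma potential_addw eta x L :
  potential (addw eta x, L) = potential (eta, L) + exit_time R K x.+1.
Proof.
rewrite /potential (bigD1 x) //= [in RHS](bigD1 x) //= addw_same.
rewrite (eq_bigr (fun y => (nwalks (eta y))%:R * exit_time R K y.+1)) => [|y yx].
  by case: (eta x) => [n|] /=; rewrite ?[in LHS]natr1 -?natr1; ring.
by rewrite addwE // eq_sym.
Qed.

Lemma toppling_mean_addw g eta x L : toppling_mean x g (addw eta x, L)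
  = lambda / (1 + lambda) * g (topple None x (addw eta x, L))
  + (1 + lambda)^-1 * (2^-1 * g (topple (Some false) x (addw eta x, L))
                      + 2^-1 * g (topple (Some true) x (addw eta x, L))).
Proof. by rewrite /toppling_mean sum_option_bool /=; ring. Qed.

Lemma potential_topple_left eta x L : eta x <> None ->
  potential (topple (Some false) x (addw eta x, L)) = potential (eta, L) + exit_time R K x.
Proof.
move=> ex; case x0 : (nat_of_ord x) => [|i].
  by rewrite topple_exit //= /exit_time mul0r addr0.
have iK : (i < K.*2.+1)%N by have := ltn_ord x; lia.
rewrite (@topple_jump _ _ _ (Ordinal iK)) ?x0 //; last first.
  by rewrite -(inj_eq val_inj) /= x0; lia.
exact: potential_addw.
Qed.

Lemma potential_topple_right eta x L : eta x <> None ->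
  potential (topple (Some true) x (addw eta x, L)) = potential (eta, L) + exit_time R K x.+2.
Proof.
move=> ex; have [xK|xK] := eqVneq (nat_of_ord x) K.*2.
  by rewrite topple_exit //= /exit_time /exit_point xK subrr mulr0 addr0.
have iK : (x.+1 < K.*2.+1)%N by have := ltn_ord x; lia.
rewrite (@topple_jump _ _ _ (Ordinal iK)) //; last first.
  by rewrite -(inj_eq val_inj) /=; lia.
exact: potential_addw.
Qed.

Lemma potential_topple_sleep eta x L : eta x <> None ->
  potential (topple None x (addw eta x, L)) = potential (addw eta x, L).
Proof.
case e : (eta x) => [[|n]|] // _; last by rewrite (topple_sleep_accompanied _ e).
rewrite topple_sleep_alone //; apply: eq_bigr => z _; rewrite /= !ffunE.
by case: eqP => // ->; rewrite e.
Qed.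

Lemma potential_mean s x : is_active (s.1 x) ->
  toppling_mean x potential s = potential s - (1 + lambda)^-1.
Proof.
case: s => eta L /= /active_addwP[n ex ->]; set eta' := upd _ _ _.
have ex' : eta' x <> None by rewrite ffunE eqxx.
rewrite toppling_mean_addw potential_topple_sleep // potential_topple_left //.
rewrite potential_topple_right // potential_addw.
have -> : exit_time R K x.+1 = 2^-1 * exit_time R K x + 2^-1 * exit_time R K x.+2 + 1.
  by rewrite exit_time_mean subrK.
by field.
Qed.

Definition unstable_ind s : R := (total_rate lambda s.1 != 0)%:R.

Lemma step_mean_potential s :
  step_mean potential s = potential s - (1 + lambda)^-1 * unstable_ind s.
Proof.
rewrite /unstable_ind; case: (boolP (total_rate lambda s.1 == 0)) => h.
  by rewrite step_mean_stable // mulr0 subr0.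
move: (h); rewrite total_rate_eq0 => /forallPn[x /negPn ax].
by rewrite mulr1; apply: (step_mean_const ax) => y; exact: potential_mean.
Qed.

(** Stable states are absorbing. *)
Lemma unstable_ind_decr n s :
  iter n.+1 step_mean unstable_ind s <= iter n step_mean unstable_ind s.
Proof.
elim: n s => [|n IH] s; last exact: le_step_mean.
rewrite /= /unstable_ind; case: (boolP (total_rate lambda s.1 == 0)) => h.
  by rewrite step_mean_stable //= h.
rewrite /step_mean (negbTE h) /=.
apply: (@le_trans _ _ (\sum_x rate lambda s.1 x / total_rate lambda s.1)).
  apply: ler_sum => x _; rewrite -[leRHS]mulr1 ler_wpM2l //.
    by rewrite divr_ge0 ?rate_ge0 ?total_rate_ge0.
  apply: (@le_trans _ _ (\sum_o outcome_prob o)); last by rewrite outcome_prob_sum.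
  apply: ler_sum => o _.
  apply: ler_piMr; first exact: outcome_prob_ge0.
  by case: (_ != 0); rewrite /= ?ler01.
by rewrite -mulr_suml -/(total_rate lambda s.1) divff.
Qed.

(** Each ring at an unstable state lowers the mean potential by [(1 + lambda)^-1], which bounds the
    sum over time of the probabilities of instability; these are nonincreasing in time. *)
Lemma unstable_ind_le n s :
  n%:R * iter n step_mean unstable_ind s <= (1 + lambda) * potential s.
Proof.
suff h m : iter m step_mean potential s
    <= potential s - m%:R * (1 + lambda)^-1 * iter m step_mean unstable_ind s.
  have := le_trans (iter_step_mean_ge0 n potential_ge0 s) (h n).
  rewrite subr_ge0 => h'; rewrite -ler_pdivrMl //.
  by rewrite mulrA [_^-1 * _]mulrC.
elim: m => [|m IH]; first by rewrite !mul0r subr0.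
have -> : iter m.+1 step_mean potential s = iter m step_mean potential s
    + (- (1 + lambda)^-1) * iter m step_mean unstable_ind s.
  rewrite iterSr -iter_step_mean_lin; congr (iter m step_mean _ s).
  by apply/funext => s'; rewrite step_mean_potential mulNr.
have := unstable_ind_decr m s; set u := iter m _ _ _; set v := iter m.+1 _ _ _ => vu.
apply: (le_trans (lerD IH (lexx _))); rewrite -/u.
have l1 : 0 <= (1 + lambda)^-1 by rewrite invr_ge0 ltW.
have : m.+1%:R * (1 + lambda)^-1 * v <= m.+1%:R * (1 + lambda)^-1 * u.
  by rewrite ler_wpM2l // mulr_ge0.
rewrite -natr1; lra.
Qed.

End JumpChain.
(** * Launching the walks one at a time *)

Section LaunchBound.
Variables (R : realType) (K : nat) (lambda : R) (l : nat).
Hypothesis lambda_gt0 : 0 < lambda.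
Hypothesis lambda_small : lambda * (K.+1%:R ^+ 2) <= 500^-1.
Implicit Types (eta : config K) (res : {set site K}) (s : state K) (w x y z : site K).
Implicit Types (k n L : nat) (psi : R).

Let U : {set site K} := centered K (K %/ 2)%N.

Let N : R := (exit_point K)%:R.

Definition num_asleep eta : nat := #|[set x | eta x == asleep]%SET|.

(** The summand of the theorem for alpha = ln 8, set to 0 at unstable states as the abelian property
    requires. *)
Definition final_weight s : R :=
  (total_rate lambda s.1 == 0)%:R * (s.2 == l)%:R * 8 ^+ num_asleep s.1.

Local Notation total := (launch_sum lambda final_weight).

Definition site_weight (a : occupation) (b : bool) : R :=
  if a is Some n then 4 ^+ (n - b) else 8.

(* [res] is the set of the sites of U whose initial walk was not launched yet. *)
Definition weight eta res : R := \prod_x site_weight (eta x) (x \in res).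

Definition proper eta res : Prop :=
  forall x, x \in res -> x \in U /\ is_active (eta x).

Lemma site_weight_ge1 a b : 1 <= site_weight a b.
Proof. by case: a => [n|] /=; [apply: exprn_ege1; lra | lra]. Qed.

Lemma weight_ge1 eta res : 1 <= weight eta res.
Proof.
apply: (big_ind (fun u : R => 1 <= u)) => [|u v u1 v1|x _]; first exact: lexx.
  by rewrite -[1]mul1r ler_pM.
exact: site_weight_ge1.
Qed.

Lemma weight_upd eta res x a :
  weight (upd eta x a) res * site_weight (eta x) (x \in res)
  = weight eta res * site_weight a (x \in res).
Proof.
rewrite /weight (bigD1 x) //= [in RHS](bigD1 x) //= ffunE eqxx.
rewrite (eq_bigr (fun y => site_weight (eta y) (y \in res))); first by ring.
by move=> y yx; rewrite ffunE (negbTE yx).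
Qed.

(** At weight 1 the factor [8 * psi - 16] is negative, so a left exit lowers the bound; at larger
    weights the gain comes from waking a sleeper. At L = l the value is [8 * psi]. *)
Definition bnd L psi : R :=
  if (L <= l)%N then 16 + (15 / 16) ^+ (l - L) * (8 * psi - 16) else 0.

Lemma ratio_bounds j : 0 < (15 / 16 : R) ^+ j <= 1.
Proof. by rewrite exprn_gt0 ?exprn_ile1 //; lra. Qed.

Lemma bnd_ge0 L psi : 0 <= psi -> 0 <= bnd L psi.
Proof.
rewrite /bnd; case: ifP => // _ p0; have /andP[r0 r1] := ratio_bounds (l - L).
by have := mulr_ge0 (ltW r0) p0; nra.
Qed.

Lemma le_bnd L psi psi' : psi <= psi' -> bnd L psi <= bnd L psi'.
Proof.
rewrite /bnd; case: ifP => // _ pp; have /andP[r0 r1] := ratio_bounds (l - L).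
by rewrite lerD2l ler_pM2l //; lra.
Qed.

Lemma bnd_succ L psi : (L <= l)%N -> bnd L.+1 psi =
  if L == l then 0 else 16 + (15 / 16) ^+ (l - L) * (16 / 15 * (8 * psi - 16)).
Proof.
rewrite /bnd leq_eqVlt; case: eqVneq => [->|_] /=; first by rewrite ltnn.
move=> Ll; rewrite Ll -(subnSK Ll) exprS; set r := _ ^+ _.
by field.
Qed.

(* The first two terms interpolate linearly between the two exits. The last   *)
(* one solves a Poisson equation whose source bounds the mean loss caused by   *)
(* an attempt to sleep (see walk_bnd_sleep).                                   *)
Definition walk_bnd L psi psil psir (c : nat) : R :=
  (1 - c%:R / N) * bnd L.+1 psil + c%:R / N * bnd L psir
  + lambda * exit_time R K c * ((15 / 16) ^+ (l - L) * (64 * psi + 16 / 15)).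

(** * Inequalities for the supersolution of one walk *)

Let N_gt0 : 0 < N.
Proof. by rewrite /N ltr0n. Qed.

Lemma ratio_exit_point x : 0 <= x.+1%:R / N <= 1.
Proof.
rewrite divr_ge0 ?ler0n ?(ltW N_gt0) //= ler_pdivrMr // mul1r /N ler_nat /exit_point.
by have := ltn_ord x; lia.
Qed.

Lemma ratio_centered x : x \in U -> 4^-1 <= x.+1%:R / N <= 3 / 4.
Proof.
rewrite inE /pos => xU.
have [h1 h2] : (exit_point K <= x.+1 * 4)%N /\ (x.+1 * 4 <= exit_point K * 3)%N.
  by rewrite /exit_point; lia.
rewrite ler_pdivlMr // ler_pdivrMr // /N.
move: h1 h2; rewrite -!(ler_nat R) !natrM => h1 h2.
by apply/andP; split; lra.
Qed.

Lemma lambda_exit_time x : 0 <= lambda * exit_time R K x.+1 <= 500^-1.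
Proof.
rewrite (mulr_ge0 (ltW lambda_gt0) (exit_time_ge0 R x)) /=.
apply: le_trans lambda_small; rewrite ler_pM2l // /exit_time /exit_point.
have -> : (K.*2.+2)%:R = 2 * K.+1%:R :> R by rewrite -natrM; congr _%:R; lia.
by rewrite -subr_ge0; set u := K.+1%:R; set v := x.+1%:R; have := sqr_ge0 (u - v); nra.
Qed.

Lemma walk_bnd_ge0 L psi psil psir x : 0 <= psi -> 0 <= psil -> 0 <= psir ->
  0 <= walk_bnd L psi psil psir x.+1.
Proof.
move=> p0 pl0 pr0; have /andP[q0 q1] := ratio_exit_point x.
have /andP[a0 _] := lambda_exit_time x; have /andP[r0 _] := ratio_bounds (l - L).
rewrite /walk_bnd !addr_ge0 // mulr_ge0 ?bnd_ge0 ?subr_ge0 //.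
by rewrite mulr_ge0 ?(ltW r0) //; lra.
Qed.

Lemma walk_bnd_left L psi psil psir : walk_bnd L psi psil psir 0 = bnd L.+1 psil.
Proof. by rewrite /walk_bnd /exit_time !mul0r mulr0 !mul0r !addr0 subr0 mul1r. Qed.

Lemma walk_bnd_right L psi psil psir :
  walk_bnd L psi psil psir (exit_point K) = bnd L psir.
Proof.
rewrite /walk_bnd /exit_time -/N subrr mulr0 mulr0 mul0r addr0 divff ?gt_eqF //.
by rewrite subrr mul0r add0r mul1r.
Qed.

Lemma walk_bnd_mean L psi psil psir c :
  2^-1 * walk_bnd L psi psil psir c + 2^-1 * walk_bnd L psi psil psir c.+2
  = walk_bnd L psi psil psir c.+1
    - lambda * ((15 / 16) ^+ (l - L) * (64 * psi + 16 / 15)).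
Proof.
rewrite /walk_bnd /exit_time -/N; set d := (_ * (64 * _ + _)).
by rewrite -!natr1; field; rewrite gt_eqF.
Qed.

(** With r the power of 15/16, each exit is worth at least 16 - r 256/15, while [bnd L (8 * psi)] is
    16 + r (64 psi - 16); the difference is r (64 psi + 16/15). *)
Lemma walk_bnd_sleep L psi psil psir x : (L <= l)%N ->
  0 <= psi -> 0 <= psil -> 0 <= psir ->
  bnd L (8 * psi) <= walk_bnd L psi psil psir x.+1
     + (15 / 16) ^+ (l - L) * (64 * psi + 16 / 15).
Proof.
move=> Ll p0 pl0 pr0; have /andP[q0 q1] := ratio_exit_point x.
have /andP[a0 _] := lambda_exit_time x; have /andP[r0 r1] := ratio_bounds (l - L).
set r := _ ^+ _ in r0 r1 *.
suff h : 16 - r * (16 * (16 / 15)) <= walk_bnd L psi psil psir x.+1.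
  by move: h; rewrite /bnd Ll -/r; lra.
have bl : 16 - r * (16 * (16 / 15)) <= bnd L.+1 psil.
  rewrite bnd_succ //; case: eqVneq => [Ll'|_].
    by rewrite /r Ll' subnn expr0; lra.
  by have := mulr_ge0 (ltW r0) pl0; rewrite -/r; lra.
have br : 16 - r * (16 * (16 / 15)) <= bnd L psir.
  by rewrite /bnd Ll -/r; have := mulr_ge0 (ltW r0) pr0; lra.
have q1' : 0 <= 1 - x.+1%:R / N by lra.
have := ler_wpM2l q1' bl; have := ler_wpM2l q0 br.
have : 0 <= lambda * exit_time R K x.+1 * (r * (64 * psi + 16 / 15)).
  by rewrite mulr_ge0 // mulr_ge0 ?(ltW r0) //; lra.
by rewrite /walk_bnd -/r; lra.
Qed.

(* Here q is the probability to exit from the right, and a bounds the mean    *)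
(* cost of the attempts to sleep.                                             *)
Lemma launch_arith (q a Psi psi psil psir : R) :
  4^-1 <= q <= 3 / 4 -> 0 <= a <= 500^-1 -> 1 <= Psi ->
  0 <= psi <= Psi ->
  [\/ [/\ Psi = 1, psil = 1 & psir = 1], psil = Psi / 2 /\ psir = Psi |
      psil = Psi /\ psir = Psi / 2] ->
  (1 - q) * (16 / 15 * (8 * psil - 16)) + q * (8 * psir - 16)
    + a * (64 * psi + 16 / 15) <= 8 * Psi - 16
  /\ q * (8 * psir) + a * (64 * psi + 16 / 15) <= 7 * Psi.
Proof.
move=> /andP[q1 q2] /andP[a1 a2] P1 /andP[p0 p1] h.
have ha : a * (64 * psi + 16 / 15) <= 500^-1 * (64 * Psi + 16 / 15).
  by rewrite ler_pM //; lra.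
have qP1 : 4^-1 * Psi <= q * Psi by rewrite ler_wpM2r //; lra.
have qP2 : q * Psi <= 3 / 4 * Psi by rewrite ler_wpM2r //; lra.
(* The tight case is Psi = 1, q = 3/4: the gain 2/15 from left exits must exceed (64 + 16/15)/500,
   whence the constant 500. *)
by case: h => [[e1 e2 e3]|[e1 e2]|[e1 e2]]; subst; split; lra.
Qed.

(** At L = l a left exit leaves nothing more to sum; the amount saved pays for the term of the
    series collected just before a launch. *)
Lemma walk_bnd_launch L Psi psi psil psir x : (L <= l)%N -> x \in U ->
  1 <= Psi -> 0 <= psi <= Psi ->
  [\/ [/\ Psi = 1, psil = 1 & psir = 1], psil = Psi / 2 /\ psir = Psi |
      psil = Psi /\ psir = Psi / 2] ->
  walk_bnd L psi psil psir x.+1 <= bnd L Psi - (L == l)%:R * Psi.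
Proof.
move=> Ll xU P1 pP h; have hq := ratio_centered xU; have ha := lambda_exit_time x.
have [h1 h2] := launch_arith hq ha P1 pP h.
have /andP[r0 r1] := ratio_bounds (l - L).
rewrite /walk_bnd bnd_succ // /bnd Ll; case: eqVneq => [->|_] /=.
  by rewrite subnn expr0; lra.
set r := _ ^+ _ in r0 r1 *; have := ler_wpM2l (ltW r0) h1; lra.
Qed.

(** Here the walk may start near an end of V, where one of the exits is unlikely; the factor 4 freed
    by no longer counting it in the weight suffices. *)
Lemma walk_bnd_woken L psi x : (L <= l)%N -> 1 <= psi ->
  walk_bnd L psi psi psi x.+1 <= bnd L (4 * psi).
Proof.
move=> Ll p1; have /andP[q0 q1] := ratio_exit_point x.
have /andP[a0 a1] := lambda_exit_time x; have /andP[r0 r1] := ratio_bounds (l - L).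
have ha : lambda * exit_time R K x.+1 * (64 * psi + 16 / 15)
    <= 500^-1 * (64 * psi + 16 / 15) by rewrite ler_wpM2r //; lra.
have qp : x.+1%:R / N * psi <= psi by rewrite ler_piMl //; lra.
have qp0 : 0 <= x.+1%:R / N * psi by rewrite mulr_ge0 //; lra.
rewrite /walk_bnd bnd_succ // /bnd Ll; case: eqVneq => [->|_].
  by rewrite subnn expr0; lra.
set r := _ ^+ _ in r0 r1 *; set q := _ / N in q0 q1 qp qp0 *.
set a := _ * exit_time _ _ _ in a0 a1 ha *.
have h : (1 - q) * (16 / 15 * (8 * psi - 16)) + q * (8 * psi - 16)
    + a * (64 * psi + 16 / 15) <= 8 * (4 * psi) - 16 by lra.
have := ler_wpM2l (ltW r0) h; lra.
Qed.

(** * Weights along topplings, and the induction over launches *)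

Lemma final_weight_unstable s : total_rate lambda s.1 != 0 -> final_weight s = 0.
Proof. by rewrite /final_weight => /negbTE ->; rewrite !mul0r. Qed.

Lemma final_weight_ge0 s : 0 <= final_weight s.
Proof. by rewrite /final_weight !mulr_ge0 // exprn_ge0. Qed.

Lemma iter_final_weight_exits n s : (l < s.2)%N ->
  iter n (step_mean lambda) final_weight s = 0.
Proof.
elim: n s => [|n IH] s ls /=; first by rewrite /final_weight gtn_eqF // mulr0 mul0r.
rewrite /step_mean; case: ifP => _; first exact: IH.
rewrite big1 // => x _; rewrite /toppling_mean big1 ?mulr0 // => o _.
by rewrite IH ?mulr0 //= (leq_trans ls) // leq_addr.
Qed.

Lemma total_exits k n s : (l < s.2)%N -> total k n s = 0.
Proof.
by move=> ls; rewrite /launch_sum big1 // => m _; rewrite iter_final_weight_exits.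
Qed.

Lemma proper_upd eta res x a : proper eta res -> (x \in res -> is_active a) ->
  proper (upd eta x a) res.
Proof.
move=> pr xa y yr; have [yU ay] := pr y yr; split=> //.
by rewrite ffunE; case: eqP => // e; apply: xa; rewrite -e.
Qed.

Lemma proper_inactive eta res x : proper eta res -> ~~ is_active (eta x) ->
  x \notin res.
Proof. by move=> pr ax; apply/negP => /pr[_]; apply/negP. Qed.

Lemma weight_wake eta res x : proper eta res -> eta x = None ->
  weight (upd eta x (Some 1)) res = weight eta res / 2.
Proof.
move=> pr ex; have xr : x \notin res by apply: proper_inactive pr _; rewrite ex.
have := weight_upd eta res x (Some 1); rewrite ex (negbTE xr) /= expr1; lra.
Qed.

Lemma weight_sleep eta res x : proper eta res -> eta x = Some 0 ->
  weight (upd eta x None) res = 8 * weight eta res.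
Proof.
move=> pr ex; have xr : x \notin res by apply: proper_inactive pr _; rewrite ex.
have := weight_upd eta res x None; rewrite ex (negbTE xr) /= expr0; lra.
Qed.

Lemma weight_sub1 eta res x n : eta x = Some n.+1 -> ((x \in res) <= n)%N ->
  weight (upd eta x (Some n)) res = weight eta res / 4.
Proof.
move=> ex xn; have := weight_upd eta res x (Some n).
rewrite ex /= subSn // exprS; set u := 4 ^+ _ => h.
have u0 : u != 0 by rewrite expf_neq0 // pnatr_eq0.
by apply: (mulIf u0); lra.
Qed.

Lemma weight_unlaunched eta res x : eta x = Some 1 -> x \in res ->
  weight (upd eta x (Some 0)) (res :\ x)%SET = weight eta res.
Proof.
move=> ex xr; apply: eq_bigr => y _; rewrite ffunE !inE.
by case: eqP => [->|_] //=; rewrite ex xr.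
Qed.

Lemma weight_stable eta res : proper eta res -> total_rate lambda eta == 0 ->
  weight eta res = 8 ^+ num_asleep eta.
Proof.
rewrite total_rate_eq0 // => pr /forallP st.
rewrite /num_asleep -prodr_const [RHS]big_mkcond /=; apply: eq_bigr => x _.
by rewrite !inE; have := st x; case: (eta x) => [[|n]|].
Qed.

(* The walk cannot exit through a side where a walk sleeps without waking it,  *)
(* which halves the weight.                                                    *)
Definition covers (side : pred (site K)) eta (p v : R) : Prop :=
  v <= p \/ exists z, [/\ side z, eta z = None & v <= 2 * p].

(** The walk in motion is not counted in [weight eta res]. The parameter [psi] serves for attempts
    to sleep, [psil] and [psir] for the weight left after each exit. *)
Definition walk_bounded k n : Prop :=
  forall eta res w L psi psil psir, (L <= l)%N -> proper eta res -> eta w <> None ->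
  weight eta res <= psi ->
  covers (fun z => (z < w)%N) eta psil (weight eta res) ->
  covers (fun z => (w < z)%N) eta psir (weight eta res) ->
  total k n (addw eta w, L) <= walk_bnd L psi psil psir w.+1.

Definition config_bounded k n : Prop :=
  forall eta res L, proper eta res -> total k n (eta, L) <= bnd L (weight eta res).

Lemma covers_ge0 side eta p res : covers side eta p (weight eta res) -> 0 <= p.
Proof. by have := weight_ge1 eta res => w1 [|[z [_ _]]]; lra. Qed.

Lemma covers_half side eta p res : covers side eta p (weight eta res) ->
  weight eta res / 2 <= p.
Proof. by have := weight_ge1 eta res => w1 [|[z [_ _]]]; lra. Qed.

(** If no walk sleeps at y, the sleepers stay on the same side of the moving walk. Otherwise the
    sleeper at y wakes, and the halved weight is below both [psil] and [psir]. *)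
Lemma walk_bounded_arrive k n eta res w y L psi psil psir : walk_bounded k n ->
  (L <= l)%N -> proper eta res -> eta w <> None -> weight eta res <= psi ->
  covers (fun z => (z < w)%N) eta psil (weight eta res) ->
  covers (fun z => (w < z)%N) eta psir (weight eta res) ->
  (y <= w.+1)%N -> (w <= y.+1)%N ->
  total k n (addw eta y, L) <= walk_bnd L psi psil psir y.+1.
Proof.
move=> wk Ll pr ew wp cl cr yw wy; have w1 := weight_ge1 eta res.
case ey : (eta y) => [m|].
- have ny z : eta z = None -> nat_of_ord z <> y.
    by move=> ez /val_inj e; move: ey; rewrite -e ez.
  apply: (wk _ res) => //; first by rewrite ey.
    case: cl => [|[z [zw ez zp]]]; [by left|right; exists z; split=> //].
    by have := ny z ez; lia.
  case: cr => [|[z [zw ez zp]]]; [by left|right; exists z; split=> //].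
  by have := ny z ez; lia.
- rewrite addw_asleep //; apply: (wk _ res) => //; rewrite ?(weight_wake pr ey).
  + exact: proper_upd.
  + by rewrite ffunE eqxx.
  + lra.
  + by left; exact: covers_half cl.
  + by left; exact: covers_half cr.
Qed.

Lemma walk_bounded_step k n :
  walk_bounded k n -> config_bounded k n -> walk_bounded k n.+1.
Proof.
move=> wk cf eta res w L psi psil psir Ll pr ew wp cl cr.
have w1 := weight_ge1 eta res; have p0 : 0 <= psi by lra.
have pl0 := covers_ge0 cl; have pr0 := covers_ge0 cr.
have l0 : 0 < 1 + lambda by rewrite addr_gt0.
set D := (15 / 16) ^+ (l - L) * (64 * psi + 16 / 15).
have hs : total k n (topple None w (addw eta w, L)) <= walk_bnd L psi psil psir w.+1 + D.
  case e : (eta w) ew => [[|m]|] // ew.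
    rewrite topple_sleep_alone //.
    apply: (le_trans _ (walk_bnd_sleep w Ll p0 pl0 pr0)).
    apply: le_trans (cf _ res _ _) (le_bnd _ _).
      by apply: proper_upd => // /pr[_]; rewrite e.
    by rewrite (weight_sleep pr e) ler_pM2l.
  rewrite (topple_sleep_accompanied _ e).
  apply: (@le_trans _ _ (walk_bnd L psi psil psir w.+1)).
    by apply: (wk _ res) => //; rewrite e.
  rewrite lerDl; have /andP[r0 _] := ratio_bounds (l - L).
  by rewrite mulr_ge0 ?(ltW r0) //; lra.
have hl : total k n (topple (Some false) w (addw eta w, L)) <= walk_bnd L psi psil psir w.
  case w0 : (nat_of_ord w) => [|i].
    rewrite topple_exit // walk_bnd_left addn1.
    apply: le_trans (cf _ res _ pr) (le_bnd _ _).
    by case: cl => [//|[z []]]; rewrite w0.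
  have iK : (i < K.*2.+1)%N by rewrite (leq_trans _ (ltn_ord w)) // w0.
  rewrite (@topple_jump _ _ _ (Ordinal iK)) ?w0 //.
    by apply: (walk_bounded_arrive wk _ pr ew) => //=; rewrite w0 // !leqW.
  by rewrite -(inj_eq val_inj) /= w0 neq_ltn ltnSn.
have hr : total k n (topple (Some true) w (addw eta w, L)) <= walk_bnd L psi psil psir w.+2.
  have [wK|wK] := eqVneq (nat_of_ord w) K.*2.
    rewrite topple_exit // wK walk_bnd_right addn0.
    apply: le_trans (cf _ res _ pr) (le_bnd _ _).
    by case: cr => [//|[z []]]; rewrite wK ltnNge -ltnS ltn_ord.
  have iK : (w.+1 < K.*2.+1)%N by rewrite ltnS ltn_neqAle wK -ltnS ltn_ord.
  rewrite (@topple_jump _ _ _ (Ordinal iK)) //.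
    by apply: (walk_bounded_arrive wk _ pr ew) => //=; rewrite !leqW.
  by rewrite -(inj_eq val_inj) /= neq_ltn ltnSn orbT.
rewrite (@launch_sum_topple _ _ _ lambda_gt0 _ _ _ _ w) //; first last.
- exact: active_addw.
- exact: final_weight_unstable.
rewrite toppling_mean_addw.
(* The excess D of an attempt to sleep is offset exactly by the decrease lambda D in the mean over
   the two jumps. *)
apply: (@le_trans _ _ (lambda / (1 + lambda) * (walk_bnd L psi psil psir w.+1 + D)
   + (1 + lambda)^-1 * (walk_bnd L psi psil psir w.+1 - lambda * D))); last first.
  rewrite le_eqVlt; apply/orP; left; apply/eqP; field; exact: lt0r_neq0.
rewrite -walk_bnd_mean lerD // ler_wpM2l ?divr_ge0 ?invr_ge0 ?(ltW l0) ?(ltW lambda_gt0) //.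
by rewrite lerD // ler_wpM2l.
Qed.

Lemma walk_bounded0 k : walk_bounded k 0.
Proof.
move=> eta res w L psi psil psir Ll pr ew wp cl cr.
have w1 := weight_ge1 eta res.
rewrite (@launch_sum0 _ _ _ lambda_gt0 _ _ _ w).
- by apply: walk_bnd_ge0; [lra|exact: covers_ge0 cl|exact: covers_ge0 cr].
- exact: final_weight_unstable.
- exact: active_addw.
Qed.

Lemma launch_bounded k n eta res w L Psi : walk_bounded k n -> (L <= l)%N ->
  proper eta res -> w \in U -> eta w <> None -> 1 <= Psi -> weight eta res <= Psi ->
  [\/ Psi = 1, weight eta res <= Psi / 2 | exists2 z, z != w & eta z = None] ->
  total k n (addw eta w, L) <= bnd L Psi - (L == l)%:R * Psi.
Proof.
move=> wk Ll pr wU ew P1 wP h; have w1 := weight_ge1 eta res.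
case: h => [P1'|w2|[z zw ez]].
- apply: (le_trans _ (@walk_bnd_launch L Psi 1 1 1 w Ll wU P1 _ _)).
  + by apply: (wk _ res) => //; [lra|left; lra|left; lra].
  + by lra.
  + by constructor 1.
- apply: (le_trans _ (@walk_bnd_launch L Psi Psi (Psi / 2) Psi w Ll wU P1 _ _)).
  + by apply: (wk _ res) => //; left; lra.
  + by lra.
  + by constructor 2.
- have [zlw|wlz] : (z < w)%N \/ (w < z)%N.
    by move: zw; rewrite -(inj_eq val_inj) /=; lia.
  + apply: (le_trans _ (@walk_bnd_launch L Psi Psi (Psi / 2) Psi w Ll wU P1 _ _)).
    * apply: (wk _ res) => //; last by left.
      by right; exists z; split=> //; lra.
    * by lra.
    * by constructor 2.
  + apply: (le_trans _ (@walk_bnd_launch L Psi Psi Psi (Psi / 2) w Ll wU P1 _ _)).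
    * apply: (wk _ res) => //; first by left.
      by right; exists z; split=> //; lra.
    * by lra.
    * by constructor 3.
Qed.

(** Either some walk sleeps away from w, or all sites have weight 1. *)
Lemma launch_idle k n eta res w L : walk_bounded k n -> (L <= l)%N ->
  proper eta res -> w \in U -> eta w <> None ->
  (forall x n, eta x = Some n -> (n <= (x \in res))%N) ->
  total k n (addw eta w, L)
  <= bnd L (weight eta res) - (L == l)%:R * weight eta res.
Proof.
move=> wk Ll pr wU ew idle; apply: (launch_bounded wk Ll pr) => //.
  exact: weight_ge1.
case: (boolP [exists z, eta z == None]) => [/existsP[z /eqP ez]|/existsPn none].
  by constructor 3; exists z => //; apply/eqP => zw; rewrite zw in ez.
constructor 1; rewrite /weight big1 // => x _.
case e : (eta x) => [m|]; last by have := none x; rewrite e.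
by have /= := idle _ _ e; rewrite -subn_eq0 => /eqP ->.
Qed.

Lemma center_lt : (K < K.*2.+1)%N.
Proof. by lia. Qed.

Definition center : site K := Ordinal center_lt.

Lemma center_centered : center \in U.
Proof. by rewrite inE /pos /= subrr. Qed.

Lemma add0_center eta L : add0 1 (eta, L) = (addw eta center, L).
Proof.
congr (_, _); apply/ffunP => z; rewrite !ffunE /= -(inj_eq val_inj) /= /pos.
by rewrite subr_eq0 eqz_nat.
Qed.

(** Chooses the next walk: an awakened one if there is any, else one of U not launched yet, else a
    new one at 0, which uses up a term of the series. *)
Lemma config_bounded_walk k n : walk_bounded k n ->
  (forall k', k = k'.+1 -> walk_bounded k' n) -> config_bounded k n.
Proof.
move=> wk wk' eta res L pr; have w1 := weight_ge1 eta res.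
have [Ll|lL] := leqP L l; last first.
  by rewrite total_exits // bnd_ge0 //; lra.
case: (boolP (total_rate lambda eta == 0)) => [st|].
  case: k wk wk' => [|k] _ wk'; first by rewrite /launch_sum big_ord0 bnd_ge0 //; lra.
  rewrite launch_sum_stable // /final_weight st -(weight_stable pr st) /= mul1r.
  rewrite addrC -lerBrDr add0_center.
  move: (st); rewrite total_rate_eq0 // => /forallP inactive.
  case ec : (eta center) => [m|].
    apply: launch_idle => //; [exact: wk'|exact: center_centered|by rewrite ec|].
    by move=> x i ei; have := inactive x; rewrite ei; case: i {ei}.
  (* The new walk wakes the sleeper at 0: one of the two moves on, the other is counted as awakened,
     and the weight is already halved. *)
  rewrite addw_asleep //; apply: (@launch_bounded _ _ _ res) => //.
  - exact: wk'.
  - exact: proper_upd.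
  - exact: center_centered.
  - by rewrite ffunE eqxx.
  - by rewrite weight_wake //; lra.
  - by constructor 2; rewrite weight_wake.
rewrite total_rate_eq0 // => /forallPn[x0 /negPn ax0].
(* An active walk beyond the unlaunched one of its site is an awakened walk. *)
pose excess x := if eta x is Some n then ((x \in res) < n)%N else false.
case: (boolP [exists x, excess x]) => [/existsP[x]|/existsPn idle].
  case ex : (eta x) => [[|m]|]; rewrite /excess ex // ltnS => xm.
  have [m' em' ->] : exists2 m', eta x = Some m'.+1 & eta = addw (upd eta x (Some m')) x.
    by apply: active_addwP; rewrite ex.
  move: em'; rewrite ex => -[<-] {m'}; set eta' := upd eta x _.
  have wE : weight (addw eta' x) res = 4 * weight eta' res.
    have -> : addw eta' x = eta.
      by apply/ffunP => y; rewrite !ffunE; case: eqP => // ->.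
    by rewrite (weight_sub1 ex xm); lra.
  have w1' := weight_ge1 eta' res; rewrite wE.
  apply: le_trans _ (walk_bnd_woken x Ll w1').
  apply: (wk _ res) => //; [|by rewrite ffunE eqxx|by left|by left].
  apply: proper_upd => // xr; move: xm; rewrite xr /=.
  by case: (m).
have idle' x n' : eta x = Some n' -> (n' <= (x \in res))%N.
  by move=> ex; have := idle x; rewrite /excess ex -leqNgt.
have [n' en' etaE] := active_addwP ax0.
have [n0 xr] : n' = 0%N /\ x0 \in res.
  by have := idle' _ _ en'; case: (x0 \in res); case: n' {en' etaE}.
move: en' etaE; rewrite n0 => ex0 etaE.
rewrite -(weight_unlaunched ex0 xr) {1}etaE.
apply: le_trans (@launch_idle _ _ _ (res :\ x0)%SET _ _ wk Ll _ _ _ _) _.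
- move=> y; rewrite in_setD1 => /andP[yx yr]; have [yU ay] := pr y yr; split=> //.
  by rewrite ffunE (negbTE yx).
- by have [] := pr x0 xr.
- by rewrite ffunE eqxx.
- move=> y i; rewrite ffunE !inE; case: eqP => [_ [<-] //|_ ey /=].
  exact: idle'.
- rewrite gerBl; have := weight_ge1 (upd eta x0 (Some 0)) (res :\ x0)%SET.
  by case: (L == l); rewrite ?mul1r ?mul0r; lra.
Qed.

(** Lexicographic induction: a toppling decreases n at fixed k, a launch from a stable configuration
    decreases k at fixed n. *)
Lemma walk_config_bounded k n : walk_bounded k n /\ config_bounded k n.
Proof.
have h k' n' : (forall j, k' = j.+1 -> walk_bounded j n') -> 
    walk_bounded k' n' -> walk_bounded k' n' /\ config_bounded k' n'.
  by move=> hj hk; split=> //; exact: config_bounded_walk.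
elim: k n => [|k IHk] n; elim: n => [|n [IH1 IH2]]; apply: h => //.
- exact: walk_bounded0.
- exact: walk_bounded_step.
- by move=> j [<-]; have [] := IHk 0%N.
- exact: walk_bounded0.
- by move=> j [<-]; have [] := IHk n.+1.
- exact: walk_bounded_step.
Qed.

Lemma launch_sum_le k n xi : zero_one U xi -> total k n (xi, 0) <= 16.
Proof.
move=> [xiU xi0]; have [_ cf] := walk_config_bounded k n.
pose res := [set x in U | xi x == active 1]%SET.
have pr : proper xi res by move=> x; rewrite inE => /andP[xU /eqP ->].
apply: le_trans (cf xi res 0%N pr) _.
have -> : weight xi res = 1.
  rewrite /weight big1 // => x _; rewrite inE.
  case: (boolP (x \in U)) => xU; last by rewrite (xi0 x xU).
  by case: (xiU x xU) => ->.
rewrite /bnd leq0n; have /andP[] := ratio_bounds (l - 0); lra.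
Qed.

End LaunchBound.

(** * From the jump chain to the probability laws *)

Section Successors.
Variables (R : realType) (K : nat) (lambda : R).
Hypothesis lambda_gt0 : 0 < lambda.
Implicit Types (s : state K) (g : state K -> R).

(** A finite set carrying [step_prob s]; it contains s itself for the absorbing case. *)
Definition successors s : seq (state K) :=
  undup (s :: [seq topple o x s | x <- enum 'I_(K.*2.+1),
                                   o <- [:: None; Some false; Some true]]).

Lemma sum_delta_seq (I : eqType) (r : seq I) (a : I) (g : I -> R) :
  uniq r -> a \in r -> \sum_(i <- r) (i == a)%:R * g i = g a.
Proof.
move=> ur ar; rewrite (bigD1_seq a) //= eqxx mul1r big1 ?addr0 // => i /negbTE ->.
by rewrite mul0r.
Qed.

Lemma topple_successors s x o : topple o x s \in successors s.
Proof.
rewrite mem_undup inE; apply/orP; right.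
by apply: allpairs_f; rewrite ?mem_enum //; case: o => [[]|].
Qed.

Lemma sum_step_prob g s :
  \sum_(s' <- successors s) step_prob lambda s s' * g s' = step_mean lambda g s.
Proof.
have us : uniq (successors s) by exact: undup_uniq.
rewrite /step_prob /step_mean; case: ifP => _.
  by rewrite sum_delta_seq // mem_undup mem_head.
under eq_bigr do rewrite mulr_suml.
rewrite exchange_big; apply: eq_bigr => x _.
under eq_bigr do rewrite -mulrA.
rewrite -mulr_sumr; congr (_ * _).
under eq_bigr do rewrite /ring_prob sleep_atE jump_leftE jump_rightE !mulrDl -!mulrA.
by rewrite !big_split -!mulr_sumr !sum_delta_seq ?topple_successors //
  /toppling_mean sum_option_bool /=; ring.
Qed.

Lemma step_prob_sum1 s : \sum_(s' <- successors s) step_prob lambda s s' = 1.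
Proof.
rewrite (eq_bigr (fun s' => step_prob lambda s s' * 1)) => [|s' _]; last first.
  by rewrite mulr1.
rewrite (sum_step_prob (fun=> 1)); case: (boolP (total_rate lambda s.1 == 0)) => [st|].
  by rewrite step_mean_stable.
rewrite total_rate_eq0 // => /forallPn[x /negPn ax].
apply: (step_mean_const lambda_gt0 ax) => y _.
rewrite /toppling_mean -[RHS](outcome_prob_sum lambda_gt0).
by apply: eq_bigr => o _; rewrite mulr1.
Qed.

Lemma step_prob_ge0 s s' : 0 <= step_prob lambda s s'.
Proof.
have l1 : 0 <= 1 + lambda by rewrite addr_ge0 // ltW.
rewrite /step_prob; case: ifP => // _; apply: sumr_ge0 => x _.
rewrite mulr_ge0 ?divr_ge0 ?rate_ge0 ?total_rate_ge0 //.
by rewrite /ring_prob !addr_ge0 // !mulr_ge0 ?invr_ge0 // ltW.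
Qed.

End Successors.

(** * Cylinders and integration along the tree of finite paths *)

Section Cylinders.
Variables (R : realType) (K : nat) (lambda : R).
Hypothesis lambda_gt0 : 0 < lambda.
Variables (d : measure_display) (T : measurableType d).
Variables (Y : nat -> T -> state K) (W : nat -> T -> \bar R).
Variable P : config K -> probability T R.
Hypothesis arw : ARW lambda Y W P.
Variable eta0 : config K.

Let mu : {measure set T -> \bar R} := P eta0.

Implicit Types (n : nat) (s : nat -> state K) (t : nat -> R).

Definition timed_cylinder n s t : set T :=
  [set w | (forall i, (i <= n)%N -> Y i w = s i) /\
           (forall i, (i < n)%N -> ((t i)%:E < W i w)%E)].

(** Zero thresholds ask for positive waiting times, so that [ARW_law] applies as it stands. *)
Definition cylinder n s : set T := timed_cylinder n s (fun=> 0).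

Definition path_prob n s : R :=
  (s 0%N == (eta0, 0%N))%:R * \prod_(i < n) step_prob lambda (s i) (s i.+1).

Lemma path_prob_ge0 n s : 0 <= path_prob n s.
Proof. by rewrite mulr_ge0 // prodr_ge0 // => i _; exact: step_prob_ge0. Qed.

Lemma measurable_timed_cylinder n s t : measurable (timed_cylinder n s t).
Proof.
have -> : timed_cylinder n s t =
    \bigcap_(i in [set i | (i <= n)%N]) [set w | Y i w = s i]
    `&` \bigcap_(i in [set i | (i < n)%N]) [set w | ((t i)%:E < W i w)%E] by [].
apply: measurableI; apply: bigcap_measurableType => i _.
  exact: ARW_measurable_state arw _ _.
rewrite -[X in measurable X]setTI; apply: emeasurable_fun_o_infty => //.
exact: ARW_measurable_time arw _.
Qed.

Lemma measurable_cylinder n s : measurable (cylinder n s).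
Proof. exact: measurable_timed_cylinder. Qed.

Lemma cylinder_prob n s : mu (cylinder n s) = (path_prob n s)%:E.
Proof.
apply: etrans (ARW_law arw eta0 n s (fun=> lexx _)) _; rewrite /path_prob.
congr ((_ * _)%:E); apply: eq_bigr => i _.
by rewrite mulr0 oppr0 expR0 mul1r.
Qed.

Definition last_time n (a : R) : nat -> R := fun i => if i == n then a else 0.

Lemma last_time_cylinder_prob n s a : 0 <= a ->
  mu (timed_cylinder n.+1 s (last_time n a))
  = (path_prob n.+1 s * expR (- (total_rate lambda (s n).1 * a)))%:E.
Proof.
move=> a0; have t0 i : 0 <= last_time n a i by rewrite /last_time; case: ifP.
apply: etrans (ARW_law arw eta0 n.+1 s t0) _.
rewrite /path_prob !big_ord_recr /= /last_time eqxx; congr (_%:E).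
rewrite (eq_bigr (fun i : 'I_n => step_prob lambda (s i) (s i.+1))); first by ring.
by move=> i _; rewrite ltn_eqF // mulr0 oppr0 expR0 mul1r.
Qed.

Lemma sub_last_time_cylinder n s a : 0 <= a ->
  timed_cylinder n.+1 s (last_time n a) `<=` cylinder n.+1 s.
Proof.
move=> a0 w [Ys Wt]; split=> // i ni; apply: le_lt_trans (Wt i ni).
by rewrite lee_fin /last_time; case: ifP.
Qed.

Definition extend n s (s' : state K) : nat -> state K :=
  fun i => if (i <= n)%N then s i else s'.

Lemma path_prob_extend n s (s' : state K) :
  path_prob n.+1 (extend n s s') = path_prob n s * step_prob lambda (s n) s'.
Proof.
rewrite /path_prob big_ord_recr /= mulrA {1 4 5}/extend leq0n leqnn ltnn.
congr (_ * _ * _); apply: eq_bigr => i _.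
by rewrite /extend ltn_ord ltnW.
Qed.

Lemma sub_cylinder_extend n s (s' : state K) : cylinder n.+1 (extend n s s') `<=` cylinder n s.
Proof.
move=> w [Ys Wt]; split=> i ni; last by apply: Wt; exact: ltnW.
by rewrite Ys /extend ?ni // ltnW.
Qed.

Definition continuations n s : set T :=
  \big[setU/set0]_(s' <- successors (s n)) cylinder n.+1 (extend n s s').

Lemma measurable_continuations n s : measurable (continuations n s).
Proof. by apply: bigsetU_measurable => s' _; exact: measurable_cylinder. Qed.

Lemma sub_continuations n s : continuations n s `<=` cylinder n s.
Proof.
rewrite /continuations; elim/big_ind: _ => //.
- by move=> A B AC BC w [/AC|/BC].
- by move=> s' _; exact: sub_cylinder_extend.
Qed.

Lemma integral_continuations n s (h : T -> \bar R) : measurable_fun [set: T] h ->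
  (forall w, 0 <= h w)%E ->
  (\int[mu]_(w in continuations n s) h w
   = \sum_(s' <- successors (s n)) \int[mu]_(w in cylinder n.+1 (extend n s s')) h w)%E.
Proof.
move=> mh h0; apply: ge0_integral_bigsetU => //.
- by move=> s'; exact: measurable_cylinder.
- exact: undup_uniq.
- move=> s1 s2 _ _ [w [[Y1 _] [Y2 _]]].
  by have := Y1 n.+1 (leqnn _); rewrite (Y2 n.+1 (leqnn _)) /extend ltnn.
- exact: measurable_funTS.
Qed.

Lemma continuations_prob n s : mu (continuations n s) = (path_prob n s)%:E.
Proof.
have mc := measurable_continuations n s.
rewrite -[LHS]mul1e -(integral_cst mu mc 1%E) integral_continuations //.
rewrite (eq_bigr (fun s' : state K => (path_prob n s * step_prob lambda (s n) s')%:E)); last first.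
  move=> s' _; rewrite integral_cst; last exact: measurable_cylinder.
  by rewrite mul1e -path_prob_extend; exact: cylinder_prob.
by rewrite sumEFin -mulr_sumr step_prob_sum1 // mulr1.
Qed.

Lemma measure_diff_null (A B : set T) : measurable A -> measurable B ->
  A `<=` B -> mu A = mu B -> mu (B `\` A) = 0%E.
Proof.
move=> mA mB AB e; have fB : (mu B < +oo)%E.
  exact: le_lt_trans (probability_le1 (P eta0) mB) (ltry _).
have -> : mu (B `\` A) = (mu B - mu A)%E.
  by apply: etrans (measureD mB mA fB) _; rewrite setIidr.
by rewrite e subee // ge0_fin_numE.
Qed.

(** Transition probabilities to the successors sum to 1, so the continuations have the full mass of
    the cylinder. *)
Lemma cylinder_diff_null n s : mu (cylinder n s `\` continuations n s) = 0%E.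
Proof.
apply: measure_diff_null; last by rewrite continuations_prob cylinder_prob.
- exact: measurable_continuations.
- exact: measurable_cylinder.
- exact: sub_continuations.
Qed.

Lemma integral_cylinder n s (h : T -> \bar R) : measurable_fun [set: T] h ->
  (forall w, 0 <= h w)%E ->
  (\int[mu]_(w in cylinder n s) h w
   = \sum_(s' <- successors (s n)) \int[mu]_(w in cylinder n.+1 (extend n s s')) h w)%E.
Proof.
move=> mh h0; rewrite -integral_continuations //.
rewrite (ge0_negligible_integral _ _ _ _ (cylinder_diff_null n s)) //.
- by rewrite setDD setIidr //; exact: sub_continuations.
- by apply: measurableD; [exact: measurable_cylinder|exact: measurable_continuations].
- exact: measurable_cylinder.
- exact: measurable_funTS.
Qed.

Lemma cylinder0_prob : mu (cylinder 0 (fun=> (eta0, 0%N))) = 1%E.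
Proof. by rewrite cylinder_prob /path_prob big_ord0 eqxx mulr1. Qed.

Lemma cylinder0_null : mu (~` cylinder 0 (fun=> (eta0, 0%N))) = 0%E.
Proof.
rewrite -setTD; apply: measure_diff_null => //; first exact: measurable_cylinder.
by rewrite cylinder0_prob; apply/esym; exact: (probability_setT (P eta0)).
Qed.

(** Backward induction on the length of paths: splitting a cylinder according to its next state is
    one application of [step_mean]. *)
Lemma integral_le_iter (h : T -> \bar R) (F : state K -> R) m :
  measurable_fun [set: T] h -> (forall w, 0 <= h w)%E ->
  (forall s, \int[mu]_(w in cylinder m s) h w <= (path_prob m s * F (s m))%:E)%E ->
  (\int[mu]_w h w <= (iter m (step_mean lambda) F (eta0, 0%N))%:E)%E.
Proof.
move=> mh h0 hm.
have claim k n s : (k + n)%N = m -> (\int[mu]_(w in cylinder n s) h w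
    <= (path_prob n s * iter k (step_mean lambda) F (s n))%:E)%E.
  elim: k n s => [|k IH] n s; first by rewrite add0n => ->; exact: hm.
  rewrite addSnnS => km; rewrite integral_cylinder //= -sum_step_prob mulr_sumr.
  rewrite -sumEFin; apply: lee_sum => s' _; apply: le_trans (IH _ _ km) _.
  by rewrite path_prob_extend /extend ltnn mulrA.
have c0 := measurable_cylinder 0 (fun=> (eta0, 0%N)).
rewrite (ge0_negligible_integral _ _ _ _ cylinder0_null) //; last first.
  exact: measurableC.
rewrite setTD setCK; apply: le_trans (claim m 0%N _ (addn0 m)) _.
by rewrite /path_prob big_ord0 eqxx mulr1 mul1r.
Qed.

Lemma negligible_seq (I : eqType) (r : seq I) (A : I -> set T) :
  (forall i, mu.-negligible (A i)) -> mu.-negligible (\big[setU/set0]_(i <- r) A i).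
Proof.
move=> hA; elim/big_ind: _ => //; [exact: negligible_set0|exact: negligibleU].
Qed.

Lemma negligible_cylinders (A : set T) m :
  (forall s, mu.-negligible (A `&` cylinder m s)) -> mu.-negligible A.
Proof.
move=> hA.
have claim k n s : (k + n)%N = m -> mu.-negligible (A `&` cylinder n s).
  elim: k n s => [|k IH] n s; first by rewrite add0n => ->; exact: hA.
  rewrite addSnnS => km.
  have h1 : mu.-negligible (cylinder n s `\` continuations n s).
    exists (cylinder n s `\` continuations n s); split=> //; last exact: cylinder_diff_null.
    by apply: measurableD; [exact: measurable_cylinder|exact: measurable_continuations].
  have h2 : mu.-negligible (\big[setU/set0]_(s' <- successors (s n))
      (A `&` cylinder n.+1 (extend n s s'))).
    by apply: negligible_seq => s'; exact: IH.
  apply: negligibleS (negligibleU h1 h2) => w [Aw cw].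
  have [inC|] := pselect (continuations n s w); last by left.
  by right; rewrite -big_distrr.
have h1 : mu.-negligible (~` cylinder 0 (fun=> (eta0, 0%N))).
  exists (~` cylinder 0 (fun=> (eta0, 0%N))); split=> //; last exact: cylinder0_null.
  by apply: measurableC; exact: measurable_cylinder.
apply: negligibleS (negligibleU h1 (claim m 0%N (fun=> (eta0, 0%N)) (addn0 m))) => w Aw.
by have [c|c] := pselect (cylinder 0 (fun=> (eta0, 0%N)) w); [right|left].
Qed.

End Cylinders.

(** * Almost sure regularity and the final state *)

Section Stabilization.
Variables (R : realType) (K : nat) (lambda : R).
Hypothesis lambda_gt0 : 0 < lambda.
Variables (d : measure_display) (T : measurableType d).
Variables (Y : nat -> T -> state K) (W : nat -> T -> \bar R).
Variable P : config K -> probability T R.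
Hypothesis arw : ARW lambda Y W P.

Let moving (i : nat) (w : T) : bool := total_rate lambda (Y i w).1 != 0.

Definition regular (w : T) : Prop := forall i,
  (moving i w -> (W i w < +oo)%E) /\
  (~~ moving i w -> W i w = +oo%E /\ Y i.+1 w = Y i w).

Section AlmostSure.
Variable eta0 : config K.
Let mu : {measure set T -> \bar R} := P eta0.

Lemma expR_decay_le0 (x p r : R) : 0 < r ->
  (forall a : nat, x <= p * expR (- (r * a%:R))) -> 0 <= p -> x <= 0.
Proof.
move=> r0 h p0; rewrite leNgt; apply/negP => x0.
pose a := (Num.truncn (p / (x * r))).+1.
have ha : p < a%:R * (x * r).
  by rewrite -ltr_pdivrMr ?mulr_gt0 // truncnS_gt.
have e1 : 1 + r * a%:R <= expR (r * a%:R) by exact: expR_ge1Dx.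
have := h a; rewrite expRN ler_pdivlMr ?expR_gt0 // => h'.
have : x * (1 + r * a%:R) <= p by apply: le_trans h'; rewrite ler_pM2l.
lra.
Qed.

(** An infinite waiting time exceeds every integer a, which has probability at most p exp(- r a) on
    a cylinder of mass p and rate r > 0. *)
Lemma negligible_moving_stuck i :
  mu.-negligible [set w | moving i w /\ W i w = +oo%E].
Proof.
apply: (negligible_cylinders lambda_gt0 arw (m := i.+1)) => s.
set A := _ `&` _.
case: (boolP (total_rate lambda (s i).1 == 0)) => [st|un].
  suff -> : A = set0 by exact: negligible_set0.
  rewrite -subset0 => w [[mw _] [Yw _]].
  by move: mw; rewrite /moving Yw ?st // leqW.
have r0 : 0 < total_rate lambda (s i).1 by rewrite lt_neqAle eq_sym un total_rate_ge0.
pose B := \bigcap_(a in [set: nat]) timed_cylinder Y W i.+1 s (last_time i a%:R).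
have mB : measurable B.
  by apply: bigcapT_measurable => a; exact: (measurable_timed_cylinder arw).
exists B; split=> //; last first.
  move=> w [[mw Ww] [Yw Wt]] a _; split=> // j ji; rewrite /last_time.
  by case: eqP => [->|_]; [rewrite Ww ltry|exact: Wt].
have fB : mu B \is a fin_num.
  by rewrite ge0_fin_numE //; exact: le_lt_trans (probability_le1 (P eta0) mB) (ltry _).
have hB a : fine (mu B) <= path_prob lambda eta0 i.+1 s
    * expR (- (total_rate lambda (s i).1 * a%:R)).
  rewrite -lee_fin fineK // -(last_time_cylinder_prob arw) //.
  apply: le_measure; rewrite ?inE //; first exact: (measurable_timed_cylinder arw).
  by move=> w; apply.
apply/eqP; rewrite eq_le measure_ge0 andbT -(fineK fB) lee_fin.
by apply: (expR_decay_le0 r0 hB); exact: path_prob_ge0.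
Qed.

(** At rate 0, asking the waiting time to exceed a does not change the probability of a cylinder,
    for any a. *)
Lemma negligible_stable_ringing i :
  mu.-negligible [set w | ~~ moving i w /\ (W i w < +oo)%E].
Proof.
apply: (negligible_cylinders lambda_gt0 arw (m := i.+1)) => s.
set A := _ `&` _.
case: (boolP (total_rate lambda (s i).1 == 0)) => [/eqP st|un]; last first.
  suff -> : A = set0 by exact: negligible_set0.
  rewrite -subset0 => w [[mw _] [Yw _]].
  by move: mw; rewrite /moving Yw ?un // leqW.
apply: (@negligibleS _ _ _ _ (\bigcup_(a in [set: nat])
   (cylinder Y W i.+1 s `\` timed_cylinder Y W i.+1 s (last_time i a%:R)))).
  move=> w [[_ Ww] cw]; have [_ W0] := cw.
  have fW : W i w \is a fin_num by rewrite ge0_fin_numE // ltW // W0.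
  exists (Num.truncn (fine (W i w))).+1 => //; split=> // -[_ /(_ i (leqnn _))].
  rewrite /last_time eqxx -(fineK fW) lte_fin ltNge => /negP; apply.
  by rewrite ltW // truncnS_gt.
apply: negligible_bigcup => a.
exists (cylinder Y W i.+1 s `\` timed_cylinder Y W i.+1 s (last_time i a%:R)).
have mt := measurable_timed_cylinder arw i.+1 s (last_time i a%:R).
have mc := measurable_cylinder arw i.+1 s.
split=> //; first exact: measurableD.
apply: measure_diff_null => //; first exact: sub_last_time_cylinder.
apply: etrans (last_time_cylinder_prob arw eta0 i s (ler0n R a)) _.
apply: etrans _ (esym (cylinder_prob arw eta0 i.+1 s)).
by rewrite st mul0r oppr0 expR0 mulr1.
Qed.

Lemma negligible_stable_jump i :
  mu.-negligible [set w | ~~ moving i w /\ Y i.+1 w <> Y i w].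
Proof.
apply: (negligible_cylinders lambda_gt0 arw (m := i.+1)) => s.
set A := _ `&` _.
have [[w [[mw Yw] cw]]|A0] := pselect (A !=set0); last first.
  by move/set0P/negP/negPn/eqP: A0 => ->; exact: negligible_set0.
apply: (negligibleS (@subIsetr _ _ _)).
exists (cylinder Y W i.+1 s); split=> //; first exact: (measurable_cylinder arw).
apply: etrans (cylinder_prob arw eta0 i.+1 s) _; rewrite /path_prob big_ord_recr /=.
have [Ys _] := cw; move: mw Yw; rewrite /moving (Ys _ (leqnn _)) (Ys _ (leqnSn _)) => /negPn st ns.
by rewrite /step_prob st; move/eqP/negbTE: ns => ->; rewrite !mulr0.
Qed.

Lemma ae_regular : mu.-negligible (~` regular).
Proof.
apply: (@negligibleS _ _ _ _ (\bigcup_i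
  ([set w | moving i w /\ W i w = +oo%E]
   `|` ([set w | ~~ moving i w /\ (W i w < +oo)%E]
        `|` [set w | ~~ moving i w /\ Y i.+1 w <> Y i w])))); last first.
  apply: negligible_bigcup => i.
  apply: negligibleU; first exact: negligible_moving_stuck.
  by apply: negligibleU; [exact: negligible_stable_ringing|exact: negligible_stable_jump].
move=> w; apply: contra_notP => h i; split.
  by move=> mi; rewrite ltey; apply/eqP => Wi; apply: h; exists i => //; left.
move=> mi; split.
  apply/eqP; rewrite -leye_eq leNgt; apply/negP => Wi.
  by apply: h; exists i => //; right; left.
by apply: contra_notP h => Yi; exists i => //; right; right.
Qed.

End AlmostSure.

Lemma ring_time_ge0 n w : (0 <= ring_time W n w)%E.
Proof. by apply: sume_ge0 => i _; exact: ARW_time_ge0 arw _ _. Qed.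

Lemma le_ring_time m n w : (m <= n)%N -> (ring_time W m w <= ring_time W n w)%E.
Proof.
move=> mn; rewrite /ring_time -(subnKC mn) big_split_ord /=.
by rewrite leeDl // sume_ge0 // => i _; exact: ARW_time_ge0 arw _ _.
Qed.

(** The first stable index n0 is reached at a finite time, and the next waiting time is infinite:
    from then on [state_at] can only read indices at least n0, where Y is constant. *)
Lemma final_state_regular n w : regular w -> ~~ moving n w ->
  final_state Y W w = Y n w.
Proof.
move=> reg sn.
have [n0 sn0 n0min] := ex_minnP (ex_intro (fun n => ~~ moving n w) n sn).
have const m : (n0 <= m)%N -> Y m w = Y n0 w.
  move=> /subnKC <-; elim: (m - n0)%N => [|k IH]; first by rewrite addn0.
  rewrite addnS -[RHS]IH; have [_ st] := reg (n0 + k)%N.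
  by have [] : W (n0 + k)%N w = +oo%E /\ Y (n0 + k).+1 w = Y (n0 + k)%N w;
    first by apply: st; rewrite /moving IH.
rewrite (const n) ?n0min //.
have ftime : ring_time W n0 w \is a fin_num.
  rewrite ge0_fin_numE ?ring_time_ge0 //; apply: lte_sum_pinfty => i _.
  by apply: (reg i).1; apply: contraT => /n0min; rewrite leqNgt ltn_ord.
have after t : fine (ring_time W n0 w) <= t -> state_at Y W t w = Y n0 w.
  move=> ht.
  have ht' : (ring_time W n0 w <= t%:E)%E by rewrite -(fineK ftime) lee_fin.
  rewrite /state_at; set A := [set _ | _]; apply: const.
  have : A (xget 0%N A).
    apply: (@xgetPex _ 0%N A); exists n0; rewrite /A /= ht' /=.
    have -> : ring_time W n0.+1 w = (ring_time W n0 w + W n0 w)%E.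
      by rewrite /ring_time big_ord_recr.
    by have [-> _] := (reg n0).2 sn0; rewrite -(fineK ftime) addey ?ltry.
  rewrite {1}/A /= => /andP[_ lt]; rewrite leqNgt; apply/negP => mn0.
  by have := lt_le_trans lt (le_trans (le_ring_time w mn0) ht'); rewrite ltxx.
have near0 : \forall t \near +oo, state_at Y W t w = Y n0 w.
  by near=> t; apply: after; near: t; apply: nbhs_pinfty_ge; exact: num_real.
rewrite /final_state; set B := [set _ | _].
have [_ near1] : B (xget (Y 0 w) B).
  apply: (@xgetPex _ (Y 0 w) B); exists (Y n0 w); split=> //.
  by apply/(stableP lambda_gt0); move: sn0; rewrite negbK.
(* Two values both taken at all large times agree. *)
near +oo_R => t.
have <- : state_at Y W t w = xget (Y 0 w) B by near: t.
by near: t.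
Unshelve. all: by end_near. Qed.

End Stabilization.

(** * Expectations bounded by means of the jump chain *)

Section Expectation.
Import HBNNSimple.
Variables (R : realType) (K : nat) (lambda : R) (l : nat).
Hypothesis lambda_gt0 : 0 < lambda.
Variables (d : measure_display) (T : measurableType d).
Variables (Y : nat -> T -> state K) (W : nat -> T -> \bar R).
Variable P : config K -> probability T R.
Hypothesis arw : ARW lambda Y W P.

Definition outcome (w : T) : R := expR (ln 8 * (sleepers Y W w)%:R)
  * \1_[set w' | left_exits Y W w' = l] w.

Let outcomeE w : outcome w
  = 8 ^+ num_asleep (final_state Y W w).1 * ((final_state Y W w).2 == l)%:R.
Proof.
rewrite /outcome mulrC expRM_natr lnK ?posrE // mulrC indicE; congr (_ * _%:R).
by congr nat_of_bool; apply/idP/eqP; rewrite inE.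
Qed.

Lemma num_asleep_le (eta : config K) : (8 : R) ^+ num_asleep eta <= 8 ^+ K.*2.+1.
Proof.
apply: ler_weXn2l; first lra.
by apply: leq_trans (max_card _) _; rewrite card_ord.
Qed.

Definition outcome_bnd (s : state K) : R :=
  final_weight lambda l s + 8 ^+ K.*2.+1 * unstable_ind lambda s.

Lemma outcome_ge0 w : 0 <= outcome w.
Proof. by rewrite outcomeE mulr_ge0 // exprn_ge0. Qed.

Lemma outcome_bnd_ge0 s : 0 <= outcome_bnd s.
Proof. by rewrite addr_ge0 ?final_weight_ge0 // mulr_ge0 // exprn_ge0. Qed.

(** If the n-th state is unstable, nothing is known of the final one, but it has at most 2K + 1
    sleepers. *)
Lemma outcome_regular n w : regular lambda Y W w -> outcome w <= outcome_bnd (Y n w).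
Proof.
move=> reg; rewrite outcomeE /outcome_bnd /final_weight /unstable_ind.
case: (boolP (total_rate lambda (Y n w).1 == 0)) => st.
  rewrite (final_state_regular lambda_gt0 arw reg (n := n)) ?st //=.
  by rewrite mul1r mulr0 addr0 mulrC.
rewrite !mul0r add0r mulr1; apply: le_trans (num_asleep_le (final_state Y W w).1).
by rewrite ler_piMr ?exprn_ge0 //; case: (_ == l); rewrite /= ?ler01.
Qed.

(* [outcome] need not be measurable: its integral is the supremum of those of  *)
(* the simple functions below it.                                              *)
Lemma expectation_outcome_le eta0 n : ('E_(P eta0)[outcome]
  <= (iter n (step_mean lambda) outcome_bnd (eta0, 0%N))%:E)%E.
Proof.
rewrite unlock ge0_integralTE => [|w]; last by rewrite lee_fin outcome_ge0.
apply: ge_ereal_sup => _ [h /= hX <-].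
have -> : sintegral (P eta0) (h : T -> R) = (\int[P eta0]_w (h w)%:E)%E.
  by rewrite integral_nnsfun // patch_setT.
have mh : measurable_fun [set: T] (fun w => (h w)%:E).
  by apply/measurable_EFinP; exact: measurable_funP.
apply: (integral_le_iter lambda_gt0 arw) => // [w|s].
  by rewrite lee_fin fun_ge0.
have mc := measurable_cylinder arw n s.
apply: (@le_trans _ _ (\int[P eta0]_(w in cylinder Y W n s) (outcome_bnd (s n))%:E)%E).
  apply: ae_ge0_le_integral => //.
  - by move=> w _; rewrite lee_fin fun_ge0.
  - exact: measurable_funTS.
  - by move=> w _; rewrite lee_fin outcome_bnd_ge0.
  - apply: negligibleS (ae_regular lambda_gt0 arw eta0) => w /=.
    apply: contra_not => reg [Yw _]; apply: le_trans (hX w) _.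
    by rewrite lee_fin -(Yw n (leqnn n)) outcome_regular.
rewrite integral_cst // mulrC EFinM lee_wpmul2l ?lee_fin ?outcome_bnd_ge0 //.
by rewrite (cylinder_prob arw).
Qed.

End Expectation.

Section Series.
Variables (R : realType) (K : nat) (lambda : R) (l : nat).
Hypothesis lambda_gt0 : 0 < lambda.
Hypothesis lambda_small : lambda * (K.+1%:R ^+ 2) <= 500^-1.
Variables (d : measure_display) (T : measurableType d).
Variables (Y : nat -> T -> state K) (W : nat -> T -> \bar R).
Variable P : config K -> probability T R.
Hypothesis arw : ARW lambda Y W P.

Lemma sum_expectation_le k xi : zero_one (centered K (K %/ 2)%N) xi ->
  (\sum_(0 <= m < k) 'E_(P (add_at0 m xi))[outcome l Y W] <= 16%:E)%E.
Proof.
move=> xiU; apply/lee_addgt0Pr => e e0.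
pose B : R := \sum_(m < k) 8 ^+ K.*2.+1 * ((1 + lambda) * potential R (add0 m (xi, 0%N))).
have B0 : 0 <= B.
  apply: sumr_ge0 => m _; rewrite mulr_ge0 ?exprn_ge0 //.
  by rewrite mulr_ge0 ?potential_ge0 // addr_ge0 // ltW.
(* The number of rings is chosen after k and e, so that the k instability errors add up to at most
   e. *)
pose n := (Num.truncn (B / e)).+1.
have n0 : 0 < n%:R :> R by rewrite ltr0n.
have nB : B / n%:R <= e.
  by rewrite ler_pdivrMr // mulrC -ler_pdivrMr // ltW // truncnS_gt.
rewrite big_mkord.
apply: (@le_trans _ _ (\sum_(m < k) (iter n (step_mean lambda)
   (outcome_bnd lambda l) (add0 m (xi, 0%N)))%:E)%E).
  by apply: lee_sum => m _; exact: (expectation_outcome_le l lambda_gt0 arw).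
rewrite sumEFin -EFinD lee_fin.
apply: le_trans (lerD (launch_sum_le l lambda_gt0 lambda_small k n xiU) nB).
rewrite /launch_sum /B mulr_suml -big_split; apply: ler_sum => m _.
rewrite /outcome_bnd iter_step_mean_lin lerD2l -mulrA ler_wpM2l ?exprn_ge0 //.
by rewrite ler_pdivlMr // mulrC unstable_ind_le.
Qed.

End Series.

(** * Choice of the constants *)

(** As a ceiling adds at most 1, sqrt(lambda) (K + 1) <= 2 e^2 + 3 sqrt(lambda) <= 2 e^2 + 3 e <=
    1/25, and 1/625 < 1/500. *)
Lemma lambda_width (R : realType) (lambda e : R) : 0 < e <= 100^-1 ->
  0 < lambda <= e ^+ 2 ->
  let K := (2 * `|Num.ceil (e ^+ 2 / Num.sqrt lambda)|)%N in
  lambda * (K.+1%:R ^+ 2) <= 500^-1.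
Proof.
case/andP=> e0 e1 /andP[l0 l1] /=; set K := (2 * _)%N.
pose q := Num.sqrt lambda.
have q0 : 0 < q by rewrite sqrtr_gt0.
have qq : q ^+ 2 = lambda by rewrite sqr_sqrtr // ltW.
have q1 : q <= e by rewrite -(@ler_pXn2r _ 2) ?nnegrE ?(ltW q0) ?(ltW e0) // qq.
have c0 : 0 <= e ^+ 2 / q by rewrite divr_ge0 ?exprn_ge0 // ltW.
have hK : K.+1%:R <= 2 * (e ^+ 2 / q) + 3 :> R.
  have := ceil_itv (e ^+ 2 / q); rewrite intrD => /andP[+ _].
  have z0 : (0 <= Num.ceil (e ^+ 2 / q))%R by rewrite -(ler_int R) (le_trans c0) // ceil_ge.
  rewrite -{1}(gez0_abs z0) /K -/q -natr1 natrM mulrN1z; lra.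
rewrite -qq -exprMn.
have h : q * K.+1%:R <= 25^-1.
  apply: le_trans (ler_wpM2l (ltW q0) hK) _.
  rewrite mulrDr mulrCA mulrC [q * (_ / q)]mulrC divfK ?gt_eqF //; nra.
apply: (@le_trans _ _ (25^-1 ^+ 2)); last lra.
by rewrite ler_pXn2r ?nnegrE ?mulr_ge0 ?(ltW q0) ?invr_ge0.
Qed.

Theorem proposition8 (R : realType) :
  exists alpha delta M : R,
    [/\ 0 < alpha, 0 < delta, 0 < M &
    forall lambda : R, 0 < lambda <= delta ->
    let K := (2 * `|Num.ceil (delta / Num.sqrt lambda)|)%N in
    let U := centered K (K %/ 2)%N in
    forall (d : measure_display) (T : measurableType d)
      (Y : nat -> T -> state K) (W : nat -> T -> \bar R)
      (P : config K -> probability T R),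
    ARW lambda Y W P ->
    let S := sleepers Y W in
    let L := left_exits Y W in
    (ereal_sup [set ereal_sup
       [set \sum_(0 <= m <oo)
              'E_(P (add_at0 m xi))[
                (fun w => expR (alpha * (S w)%:R) * \1_[set w' | L w' = l] w)%R]
       | l in [set: nat]] | xi in zero_one U] <= M%:E)%E].
Proof.
(* A sleeper has weight 8, delta is e^2 for e = 1/100, and 16 bounds [bnd] at the initial weight
   1. *)
exists (ln 8), (100^-1 ^+ 2), 16; split=> //.
  by rewrite ln_gt0 //; lra.
move=> lambda hlambda K U d T Y W P arw /=.
have e01 : 0 < (100^-1 : R) <= 100^-1 by rewrite invr_gt0 lexx ltr0n.
have small := lambda_width e01 hlambda; have /andP[l0 _] := hlambda.
apply: ge_ereal_sup => _ [xi xiU <-]; apply: ge_ereal_sup => _ [l _ <-].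
apply: lime_le.
  apply: is_cvg_nneseries => m _ _; rewrite unlock; apply: integral_ge0 => w _.
  by rewrite lee_fin mulr_ge0 ?expR_ge0.
by apply: nearW => k; exact: (sum_expectation_le l l0 small arw).
Qed.
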